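(* Let $N\in\{1,2,\ldots\}$, $\mathbf{l}=(l_1,\ldots,l_N)\in\mathcal{L}^N$ and $L\in\mathcal{L}$. Let $M^{\mathbf{l},L}$ be the matrix obtained by stacking vertically the matrices $M_1,\ldots,M_{N_{\rm dim}}$, where for $d=1,\ldots,N_{\rm dim}$ and $(\mathbf{m},k),(\mathbf{m}',k')\in\mathcal{M}_{\mathbf{l}}\times\mathcal{M}_L$, $$M_d[(\mathbf{m},k),(\mathbf{m}',k')]=\begin{cases}\sum_{j=1}^N\varrho^{l_j,d}_{m_j,m_j}-\varrho^{L,d}_{k,k}, & \text{if } \mathbf{m}=\mathbf{m}',\ k=k',\\ -\varrho^{L,d}_{k,k'}, & \text{if } \mathbf{m}=\mathbf{m}',\ k\neq k',\\ \varrho^{l_j,d}_{m'_j,m_j}, & \text{if } k=k' \text{ and for some } j:\ m_j\neq m'_j \text{ and } m_s=m'_s\ \forall s\neq j,\\ 0,&\text{otherwise.}\end{cases}$$ Let $\mathbf{c}_i=\{c_{\mathbf{m},k,i}\}_{\mathbf{m}\in\mathcal{M}_{\mathbf{l}},k\in\mathcal{M}_L}$, $i=1,\ldots,\dim(\ker(M^{\mathbf{l},L}))$, be a basis of $\ker(M^{\mathbf{l},L})$. Then a basis of the space $V^{\mathbf{l},L}$ of group-equivariant functions is given by $$b_i=\Big[\sum_{\mathbf{m}\in\mathcal{M}_{\mathbf{l}}}c_{\mathbf{m},k,i}\,\phi^{\mathbf{l}}_{\mathbf{m}}\Big]_{k\in\mathcal{M}_L},\qquad i=1,\ldots,\dim(\ker(M^{\mathbf{l},L})).$$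 Thus $\dim(V^{\mathbf{l},L})=\dim(\ker(M^{\mathbf{l},L}))$.
   Context: Setting. $G$ is a connected linear Lie group with neutral element $e$ and Lie algebra $\mathfrak{g}$; $X_1,\ldots,X_{N_{\rm dim}}\in\mathfrak g$ is a set of generators of $\mathfrak{g}$. $\mathbb{K}\in\{\mathbb{R},\mathbb{C}\}$, and $\mathbb{F}$ is a $\mathbb{K}$-vector space in which values of the functions below can be multiplied (a commutative $\mathbb{K}$-algebra, e.g. $\mathbb{F}=\mathbb{K}$). $G$ acts on a domain $\Omega$ (with $e\cdot r=r$, $(g_1g_2)\cdot r=g_1\cdot(g_2\cdot r)$) and diagonally on $\Omega^N$: $g\cdot(r_1,\ldots,r_N)=(g\cdot r_1,\ldots,g\cdot r_N)$. $\mathcal{L}$ is a (countable, totally ordered) index set; for each $l\in\mathcal{L}$, $\mathcal{M}_l$ is a finite totally ordered set and $V^l=\mathrm{Span}_{\mathbb K}\{\phi^l_m: m\in\mathcal{M}_l\}$ with functions $\phi^l_m:\Omega\to\mathbb{F}$ that are orthonormal for a given scalar product: $\langle\phi^l_m,\phi^{l'}_{m'}\rangle=\delta_{ll'}\delta_{mm'}$. Each $V^l$ is stable under the group action, and $\rho^l$ denotes the resulting (continuous) matrix representation of $G$ of dimension $|\mathcal{M}_l|$ over $\mathbb K$: $\phi^l_m(g\cdot r)=\sum_{m'\in\mathcal{M}_l}\rho^l_{m,m'}(g)\phi^l_{m'}(r)$ for all $g\in G$, $r\in\Omega$. Its derivative is $d\rho^l(X)=\frac{d}{dt}\big|_{t=0}\rho^l(\exp(tX))$,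 and $\varrho^{l,d}:=d\rho^l(X_d)$, a matrix indexed by $\mathcal{M}_l\times\mathcal{M}_l$. For $\mathbf{l}\in\mathcal{L}^N$: $\mathcal{M}_{\mathbf{l}}=\mathcal{M}_{l_1}\times\cdots\times\mathcal{M}_{l_N}$, $\phi^{\mathbf{l}}_{\mathbf{m}}(r_1,\ldots,r_N)=\prod_{i=1}^N\phi^{l_i}_{m_i}(r_i)$, and $V^{\mathbf{l}}=\bigotimes_{i=1}^N V^{l_i}$, of which $\{\phi^{\mathbf{l}}_{\mathbf{m}}\}_{\mathbf{m}\in\mathcal{M}_{\mathbf{l}}}$ is an orthonormal basis (for the tensor-product scalar product). A function $F:\Omega^N\to\mathbb{F}^{|\mathcal{M}_L|}$ is group-equivariant (GE) for $\rho^L$ if $F(g\cdot R)=\rho^L(g)F(R)$ for all $g\in G$, $R\in\Omega^N$. $V^{\mathbf{l},L}$ is the $\mathbb K$-vector space of GE functions for $\rho^L$ in $[V^{\mathbf{l}}]^{|\mathcal{M}_L|}$. Kernels are taken over $\mathbb{K}$. *)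

(* Defs.v *)
From HB Require Import structures.
From mathcomp Require Import all_boot all_order all_algebra.
From mathcomp Require Import all_classical all_reals all_analysis.
From mathcomp Require Import complex.

Set Implicit Arguments.
Unset Strict Implicit.
Unset Printing Implicit Defensive.

Import Order.TTheory GRing.Theory Num.Theory numFieldNormedType.Exports.

Local Open Scope classical_set_scope.
Local Open Scope ring_scope.

Inductive scalar_kind := Reals | Complexes.

Definition scalar_field (R : realType) (k : scalar_kind) : numFieldType :=
  match k with Reals => R | Complexes => R[i] end.

Definition of_real (R : realType) (k : scalar_kind) : R -> scalar_field R k :=
  match k return R -> scalar_field R k with
  | Reals => id
  | Complexes => fun x => Complex x 0
  end.

Definition scalar_conj (R : realType) (k : scalar_kind) :
    scalar_field R k -> scalar_field R k :=
  match k return scalar_field R k -> scalar_field R k with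
  | Reals => id
  | Complexes => fun z => conjc z
  end.

Section LinearAlgebra.
Variables (R : realType) (k : scalar_kind) (V : lmodType (scalar_field R k)).

Definition lspan (S : set V) : set V :=
  [set v | exists n (a : 'I_n -> scalar_field R k) (f : 'I_n -> V),
     (forall i, S (f i)) /\ v = \sum_(i < n) a i *: f i].

(* [V] may be infinite-dimensional, so that [basis_of] does not apply. *)
Definition is_basis (S : set V) (n : nat) (b : 'I_n -> V) : Prop :=
  (forall a : 'I_n -> scalar_field R k,
     \sum_(i < n) a i *: b i = 0 -> forall i, a i = 0)
  /\ lspan (range b) = S.

Definition has_dim (S : set V) (n : nat) : Prop :=
  exists b : 'I_n -> V, is_basis S b.

(* Only the values of [ip] on the subspace [S] matter. *)
Definition is_scalar_product (S : set V) (ip : V -> V -> scalar_field R k) :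
    Prop :=
  [/\ forall a f g h, S f -> S g -> S h ->
        ip (a *: f + g) h = a * ip f h + ip g h,
      forall f g, S f -> S g -> ip g f = scalar_conj (ip f g) &
      forall f, S f -> f != 0 -> 0 < ip f f].

End LinearAlgebra.

Section LinearLieGroups.
Variables (R : realType) (n : nat).

(* Complex matrices cover the real case: GL_n(R) is closed in GL_n(C), and the
   Lie algebra below is always taken over the reals. *)
Local Notation Mat := 'M[scalar_field R Complexes]_n.

Definition rscale (t : R) (X : Mat) : Mat := of_real Complexes t *: X.

Definition mexp (X : Mat) : Mat :=
  lim (series (fun j : nat => (j`!%:R)^-1 *: X ^+ j) @ \oo).

Definition linear_lie_group (G : set Mat) : Prop :=
  [/\ forall g, G g -> g \in unitmx,
      G 1%:M,
      forall g h, G g -> G h -> G (g *m h),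
      forall g, G g -> G (invmx g) &
      forall g, g \in unitmx -> closure G g -> G g].

Definition lie_algebra (G : set Mat) : set Mat :=
  [set X | forall t : R, G (mexp (rscale t X))].

Definition lie_subalgebra (h : set Mat) : Prop :=
  [/\ h 0,
      forall (t : R) X Y, h X -> h Y -> h (rscale t X + Y) &
      forall X Y, h X -> h Y -> h (X *m Y - Y *m X)].

(* Generation as a real Lie algebra; a linear spanning set is a special case. *)
Definition lie_generates (Ndim : nat) (X : 'I_Ndim -> Mat) (g : set Mat) :
    Prop :=
  g = \bigcap_(h in [set h | lie_subalgebra h /\ range X `<=` h]) h.

Definition is_action (Omega : Type) (G : set Mat)
    (act : Mat -> Omega -> Omega) : Prop :=
  (forall r, act 1%:M r = r) /\
  (forall g h, G g -> G h -> forall r, act (g *m h) r = act g (act h r)).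

(* Matrices whose rows and columns are indexed by a finite type [I] are
   represented by their entries. *)
Definition continuous_rep (k : scalar_kind) (I : finType) (G : set Mat)
    (rho : Mat -> I -> I -> scalar_field R k) : Prop :=
  forall m m', {within G, continuous (fun g => rho g m m')}.

Definition drep (k : scalar_kind) (I : finType)
    (rho : Mat -> I -> I -> scalar_field R k) (X : Mat) (m m' : I) :
    scalar_field R k :=
  lim ((fun t : R => (of_real k t)^-1 *
          (rho (mexp (rscale t X)) m m' - rho (mexp (rscale 0 X)) m m')) @ 0^').

End LinearLieGroups.

Section FunctionSpaces.
Variables (R : realType) (k : scalar_kind) (F : comAlgType (scalar_field R k)).
Variables (Omega : Type) (L : Type) (dM : Order.disp_t).
Variables (M : L -> finOrderType dM) (phi : forall l, M l -> Omega -> F).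

Definition Vspace (l : L) : set (Omega -> F) := lspan (range (@phi l)).

Definition Vtotal : set (Omega -> F) :=
  lspan [set f | exists l m, f = @phi l m].

Definition orthonormal_family
    (ip : (Omega -> F) -> (Omega -> F) -> scalar_field R k) : Prop :=
  (forall l (m m' : M l), ip (phi m) (phi m') = (m == m')%:R) /\
  (forall l l', l <> l' ->
     forall (m : M l) (m' : M l'), ip (phi m) (phi m') = 0).

Variables (N : nat) (l : 'I_N -> L).

Definition multi_index : finType := {dffun forall i : 'I_N, M (l i)}.

Definition tensor (f : 'I_N -> Omega -> F) : ('I_N -> Omega) -> F :=
  fun r => \prod_(i < N) f i (r i).

Definition phi_multi (m : multi_index) : ('I_N -> Omega) -> F :=
  tensor (fun i => phi (m i)).

Definition Vtensor : set (('I_N -> Omega) -> F) :=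
  lspan [set tensor f | f in [set f | forall i, Vspace (l i) (f i)]].

(* For general [F] the functions [phi_multi phi m] may be linearly dependent
   (scalars R, values in C, phi_1 = 1, phi_2 = i); the existence of the tensor
   product scalar product on functions is what makes them independent. *)
Definition is_tensor_scalar_product
    (ip : (Omega -> F) -> (Omega -> F) -> scalar_field R k)
    (ipN : (('I_N -> Omega) -> F) -> (('I_N -> Omega) -> F) ->
           scalar_field R k) : Prop :=
  is_scalar_product Vtensor ipN /\
  (forall f g : 'I_N -> Omega -> F,
     (forall i, Vspace (l i) (f i)) -> (forall i, Vspace (l i) (g i)) ->
     ipN (tensor f) (tensor g) = \prod_(i < N) ip (f i) (g i)).

Variables (n : nat) (G : set 'M[scalar_field R Complexes]_n).
Variable act : 'M[scalar_field R Complexes]_n -> Omega -> Omega.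

Definition equivariant (I : finType)
    (rho : 'M[scalar_field R Complexes]_n -> I -> I -> scalar_field R k)
    (f : ('I_N -> Omega) -> {ffun I -> F}) : Prop :=
  forall g, G g -> forall (r : 'I_N -> Omega) (a : I),
    f (fun i => act g (r i)) a = \sum_(b : I) rho g a b *: f r b.

Definition GE_space (I : finType)
    (rho : 'M[scalar_field R Complexes]_n -> I -> I -> scalar_field R k) :
    set (('I_N -> Omega) -> {ffun I -> F}) :=
  [set f | equivariant rho f /\ forall a : I, Vtensor (fun r => f r a)].

End FunctionSpaces.

Section Matrix.
Variables (R : realType) (k : scalar_kind).
Variables (L : Type) (dM : Order.disp_t) (M : L -> finOrderType dM).
Variables (N Ndim : nat).
(* [varrho l d] is the derivative of the representation of index [l] at the
   [d]-th generator. *)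
Variable varrho : forall l, 'I_Ndim -> M l -> M l -> scalar_field R k.
Variables (l : 'I_N -> L) (l0 : L).

Definition index_set : finType := (multi_index M l * M l0)%type.

Definition M_entry (d : 'I_Ndim) (p q : index_set) : scalar_field R k :=
  let: (m, a) := p in
  let: (m', a') := q in
  if (m == m') && (a == a') then
    \sum_(j < N) varrho d (m j) (m j) - varrho d a a
  else if m == m' then - varrho d a a'
  else if a == a' then
    (* at most one such [j] exists *)
    if [pick j | (m j != m' j) && [forall (s | s != j), m s == m' s]] is Some j
    then varrho d (m' j) (m j)
    else 0
  else 0.

Definition M_block (d : 'I_Ndim) : 'M[scalar_field R k]_#|index_set| :=
  \matrix_(p, q) M_entry d (enum_val p) (enum_val q).

Definition M_stack :
    'M[scalar_field R k]_(\sum_(d < Ndim) #|index_set|, #|index_set|) :=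
  \mxcol_(d < Ndim) M_block d.

Definition ker_M : {vspace 'cV[scalar_field R k]_#|index_set|} :=
  lker (linfun (fun c : 'cV[scalar_field R k]_#|index_set| => M_stack *m c)).

End Matrix.

(* Main.v *)
Require Import Defs.
From HB Require Import structures.
From mathcomp Require Import all_boot all_order all_algebra.
From mathcomp Require Import all_classical all_reals all_analysis.
From mathcomp Require Import complex ring lra.

Set Implicit Arguments.
Unset Strict Implicit.
Unset Printing Implicit Defensive.

Import Order.TTheory GRing.Theory Num.Theory numFieldNormedType.Exports.

Local Open Scope classical_set_scope.
Local Open Scope ring_scope.

(** Write a function with values in the tensor product space as a combination of
    the basis functions; these are linearly independent because the tensor
    scalar product makes them orthonormal.  Arranging the coefficients in a
    matrix [T], equivariance under a group element [g] says that [T] intertwines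
    the tensor representation [P] at [g] with the target representation [Q] at
    [g], whereas the kernel condition says that [T] intertwines the derivatives
    of [P] and [Q] at the generators [X d], the derivative of [P] being given by
    the Leibniz rule ([drep_tensor], [ker_MP], [equivariant_coef_fun]).  The
    theorem is therefore the equivalence of the two conditions on [T], which is
    [intertwiner_generators].

    From the group to the generators one differentiates: along a one-parameter
    subgroup of [G] a continuous representation is an exponential
    ([one_parameter_group], [matrix_rep_exp]), and intertwining all
    exponentials is the same as intertwining the generators
    ([expm_intertwine]).  Conversely, the elements of [G] at which [T]
    intertwines [P] and [Q] form a relatively closed subgroup [H], whose Lie
    algebra contains every [X d], hence contains the Lie algebra of [G] because
    it is a Lie subalgebra ([lie_algebra_subalgebra]).  Since [G] is connected,
    [H] is all of [G] ([lie_group_rigidity]).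

    Everything about Lie groups rests on one limit ([power_limit]): if
    [(u - 1) / tau] tends to [Z] while [tau > 0] tends to [0], then the power of
    [u] with exponent the integer part of [t / tau] tends to [exp (t Z)].  A
    direction of approach to the identity inside a closed group is thus in its
    Lie algebra ([tangent_lie_algebra]); applied to products and commutators of
    exponentials this shows that the Lie algebra is a Lie algebra, and applied
    to a continuous one-parameter group it shows that the group is an
    exponential without integrating anything.  It also gives rigidity without
    local charts: if elements [g] of [G] outside [H] accumulated at the
    identity, one would translate each by an element of [H] to bring it, up to a
    factor two, as close to the identity as possible; a limit [Y] of the directions towards
    the translates [u] is in the Lie algebra of [G], so in that of [H], and
    multiplying [u] by [exp (- |u - 1| Y)], which is in [H], brings [u] much
    closer to the identity, which is absurd ([near_best_translate],
    [lie_group_nbhs1]).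

    Limits are taken along filters and measured by a real-valued entrywise norm,
    so that real and complex scalars are treated at once; compactness enters
    only through the convergence of bounded functions along ultrafilters
    ([ultra_mtends]). *)

(** * Moduli of scalars *)

Lemma squeeze_cvg0 (R : realType) (T : Type) (F : set_system T) {FF : Filter F}
    (g h : T -> R) :
  (\forall x \near F, 0 <= g x <= h x) -> h x @[x --> F] --> (0 : R) ->
  g x @[x --> F] --> (0 : R).
Proof. by move=> gh h0; exact: (squeeze_cvgr gh (cvg_cst _) h0). Qed.

Section ScalarModulus.
Variables (R : realType) (k : scalar_kind).
Local Notation K := (scalar_field R k).

Definition modulus : K -> R :=
  match k return scalar_field R k -> R with
  | Reals => fun x => `|x|
  | Complexes => fun z => Normc.normc z
  end.

Lemma modulus_ge0 z : 0 <= modulus z.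
Proof. by rewrite /modulus; case: k z => [z|[a b]] /=; rewrite ?sqrtr_ge0. Qed.

Lemma modulusD z w : modulus (z + w) <= modulus z + modulus w.
Proof.
rewrite /modulus; case: k z w => [z w|z w] /=; first exact: ler_normD.
exact: (@le_normcD R z w).
Qed.

Lemma modulusM z w : modulus (z * w) = modulus z * modulus w.
Proof.
by rewrite /modulus; case: k z w => [z w|z w] /=; [exact: normrM|exact: Normc.normcM].
Qed.

Lemma modulus_of_real (t : R) : modulus (of_real k t) = `|t|.
Proof.
by rewrite /modulus /of_real; case: k => //=; rewrite expr0n /= addr0 sqrtr_sqr.
Qed.

Lemma of_realD (s t : R) : of_real k (s + t) = of_real k s + of_real k t.
Proof. by rewrite /of_real; case: k => //=; exact: (rmorphD (real_complex R)). Qed.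

Lemma of_realM (s t : R) : of_real k (s * t) = of_real k s * of_real k t.
Proof. by rewrite /of_real; case: k => //=; exact: (rmorphM (real_complex R)). Qed.

Lemma of_real1 : @of_real R k 1 = 1.
Proof. by rewrite /of_real; case: k. Qed.

Lemma of_real0 : @of_real R k 0 = 0.
Proof. by rewrite /of_real; case: k. Qed.

Lemma of_realN (t : R) : of_real k (- t) = - of_real k t.
Proof. by apply/eqP; rewrite -subr_eq0 opprK -of_realD addNr of_real0. Qed.

Lemma of_realV (t : R) : of_real k t^-1 = (of_real k t)^-1.
Proof. by rewrite /of_real; case: k => //=; exact: (fmorphV (real_complex R)). Qed.

Lemma of_real_nat j : @of_real R k j%:R = j%:R.
Proof.
by elim: j => [|j IH]; rewrite ?of_real0// -addn1 !natrD of_realD IH of_real1.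
Qed.

Lemma of_realX (t : R) j : of_real k (t ^+ j) = of_real k t ^+ j.
Proof. by elim: j => [|j IH]; rewrite ?expr0 ?of_real1// !exprS of_realM IH. Qed.

Lemma modulus0 : modulus 0 = 0.
Proof. by rewrite -of_real0 modulus_of_real normr0. Qed.

Lemma modulus0_eq0 z : modulus z = 0 -> z = 0.
Proof.
rewrite /modulus; case: k z => [z|z] /=; first by move/normr0_eq0.
exact: Normc.eq0_normc.
Qed.

Lemma modulusN z : modulus (- z) = modulus z.
Proof. by rewrite -mulN1r modulusM -(of_real1) -of_realN modulus_of_real normrN1 mul1r. Qed.

(** The norm of [K] takes its values in [K] itself; [modulus] is its real form,
    which can be compared with real error bounds. *)
Lemma normr_modulus (z : K) : `|z| = of_real k (modulus z).
Proof. by rewrite /modulus /of_real; case: k z => // -[a b]; rewrite normc_def. Qed.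

Lemma of_real_lt (s t : R) : (of_real k s < of_real k t) = (s < t).
Proof. by rewrite /of_real; case: k => //=; rewrite ltcR. Qed.

Lemma pos_of_real (e : K) : 0 < e -> exists2 d : R, 0 < d & e = of_real k d.
Proof.
move=> e0; exists (modulus e).
  by rewrite -of_real_lt of_real0 -normr_modulus normr_gt0 gt_eqF.
by rewrite -normr_modulus gtr0_norm.
Qed.

Lemma ball_modulus (z w : K) (e : R) :
  ball z (of_real k e) w <-> modulus (z - w) < e.
Proof. by rewrite -ball_normE /ball_ /= normr_modulus of_real_lt. Qed.

(** The image of an ultrafilter on a compact interval is a filter contained in a
    convergent ultrafilter, and it decides every set, so it converges itself.
    This replaces the extraction of convergent subsequences. *)
Lemma ultra_cvg_bounded (T : Type) (U : set_system T) (f : T -> R) (B : R) :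
  UltraFilter U -> (\forall x \near U, `|f x| <= B) ->
  exists l : R, f x @[x --> U] --> l.
Proof.
move=> UU fB.
have PU : ProperFilter (f x @[x --> U]) by exact: fmap_proper_filter.
have [V [UV sV]] := ultraFilterLemma PU.
have := @segment_compact R (- B) B; rewrite compact_ultra => /(_ V UV).
have VB : V [set` `[- B, B]].
  apply: sV; near=> x; rewrite /= in_itv /= -ler_norml; near: x; exact: fB.
case/(_ VB) => l [_ Vl]; exists l => W Wl.
have [//|nW] := in_ultra_setVsetC (f @^-1` W) UU.
have V1 : V (~` W) by apply: sV.
have V2 : V W by exact: Vl.
have [y []//] := @filter_ex _ V _ _ (filterI V2 V1).
Unshelve. all: by end_near. Qed.

Lemma cvg_dist0 (T : Type) (F : set_system T) {FF : Filter F} (f : T -> R) (l : R) :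
  f x @[x --> F] --> l -> `|f x - l| @[x --> F] --> (0 : R).
Proof.
by move=> fl; apply/norm_cvg0P; rewrite -(subrr l); apply: cvgB => //; exact: cvg_cst.
Qed.

Lemma ultra_modulus_bounded (T : Type) (U : set_system T) (f : T -> K) (B : R) :
  UltraFilter U -> (\forall x \near U, modulus (f x) <= B) ->
  exists l : K, modulus (f x - l) @[x --> U] --> (0 : R).
Proof.
rewrite /modulus => UU; have PU : ProperFilter U by exact: ultra_proper.
case: k f => [f|f] /= fB.
  have [l fl] := ultra_cvg_bounded UU fB; exists l.
  exact: cvg_dist0.
have [a fa] : exists l : R, complex.Re (f x) @[x --> U] --> l.
  apply: (ultra_cvg_bounded UU (B := B)); apply: filterS fB => x; apply: le_trans.
  case: (f x) => u v /=; rewrite -(sqrtr_sqr u) ler_sqrt ?lerDl ?sqr_ge0//.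
  by rewrite addr_ge0 ?sqr_ge0.
have [b fb] : exists l : R, complex.Im (f x) @[x --> U] --> l.
  apply: (ultra_cvg_bounded UU (B := B)); apply: filterS fB => x; apply: le_trans.
  case: (f x) => u v /=; rewrite -(sqrtr_sqr v) ler_sqrt ?lerDr ?sqr_ge0//.
  by rewrite addr_ge0 ?sqr_ge0.
exists (Complex a b).
have fab0 : `|complex.Re (f x) - a| + `|complex.Im (f x) - b| @[x --> U] --> (0 : R).
  by rewrite -[X in _ --> X]addr0; apply: cvgD; exact: cvg_dist0.
apply: squeeze_cvg0 fab0; apply: nearW => x.
case: (f x) => u v /=; rewrite sqrtr_ge0 /=.
rewrite -(ler_pXn2r (n := 2)) ?nnegrE ?sqrtr_ge0 ?addr_ge0//.
rewrite sqr_sqrtr ?addr_ge0 ?sqr_ge0// [leRHS]sqrrD !real_normK ?num_real//.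
by rewrite addrAC lerDl mulrn_wge0 ?mulr_ge0.
Qed.

End ScalarModulus.

(** * Entrywise norm and convergence of matrices *)

Section MatrixNorm.
Variables (R : realType) (k : scalar_kind).
Local Notation K := (scalar_field R k).

Definition mnorm p q (A : 'M[K]_(p, q)) : R := \sum_i \sum_j modulus (A i j).

Lemma mnorm_ge0 p q (A : 'M[K]_(p, q)) : 0 <= mnorm A.
Proof. by apply: sumr_ge0 => i _; apply: sumr_ge0 => j _; exact: modulus_ge0. Qed.

Lemma modulus_le_mnorm p q (A : 'M[K]_(p, q)) i j : modulus (A i j) <= mnorm A.
Proof.
rewrite /mnorm (bigD1 i)//= (bigD1 j)//= -addrA lerDl addr_ge0//.
  by apply: sumr_ge0 => ? _; exact: modulus_ge0.
by apply: sumr_ge0 => ? _; apply: sumr_ge0 => ? _; exact: modulus_ge0.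
Qed.

Lemma mnorm0 p q : mnorm (0 : 'M[K]_(p, q)) = 0.
Proof. by apply: big1 => i _; apply: big1 => j _; rewrite mxE modulus0. Qed.

Lemma mnorm0_eq0 p q (A : 'M[K]_(p, q)) : mnorm A = 0 -> A = 0.
Proof.
move=> A0; apply/matrixP => i j; rewrite mxE; apply: modulus0_eq0.
by apply/eqP; rewrite eq_le modulus_ge0 -A0 modulus_le_mnorm.
Qed.

Lemma mnormD p q (A B : 'M[K]_(p, q)) : mnorm (A + B) <= mnorm A + mnorm B.
Proof.
rewrite /mnorm -big_split; apply: ler_sum => i _; rewrite -big_split.
by apply: ler_sum => j _; rewrite mxE modulusD.
Qed.

Lemma mnormN p q (A : 'M[K]_(p, q)) : mnorm (- A) = mnorm A.
Proof. by apply: eq_bigr => i _; apply: eq_bigr => j _; rewrite mxE modulusN. Qed.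

Lemma mnorm_distC p q (A B : 'M[K]_(p, q)) : mnorm (A - B) = mnorm (B - A).
Proof. by rewrite -mnormN opprB. Qed.

Lemma mnormZ p q (a : K) (A : 'M[K]_(p, q)) :
  mnorm (a *: A) = modulus a * mnorm A.
Proof.
rewrite /mnorm mulr_sumr; apply: eq_bigr => i _; rewrite mulr_sumr.
by apply: eq_bigr => j _; rewrite mxE modulusM.
Qed.

Lemma mnormM p q s (A : 'M[K]_(p, q)) (B : 'M[K]_(q, s)) :
  mnorm (A *m B) <= mnorm A * mnorm B.
Proof.
have modulus_sum (I : finType) (f : I -> K) :
    modulus (\sum_i f i) <= \sum_i modulus (f i).
  elim/big_ind2 : _ => [|x y z t xy zt|//]; first by rewrite modulus0.
  by apply: le_trans (modulusD _ _) _; exact: lerD.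
rewrite {1 2}/mnorm mulr_suml; apply: ler_sum => i _.
apply: (@le_trans _ _ (\sum_j \sum_r modulus (A i r) * modulus (B r j))).
  apply: ler_sum => j _; rewrite mxE; apply: le_trans (modulus_sum _ _) _.
  by apply: ler_sum => r _; rewrite modulusM.
rewrite exchange_big /= mulr_suml; apply: ler_sum => r _; rewrite -mulr_sumr.
apply: ler_wpM2l; first exact: modulus_ge0.
rewrite /mnorm (bigD1 r)//= lerDl.
by apply: sumr_ge0 => ? _; apply: sumr_ge0 => ? _; exact: modulus_ge0.
Qed.

Lemma mnorm_sum p q (I : Type) (r : seq I) (f : I -> 'M[K]_(p, q)) :
  mnorm (\sum_(i <- r) f i) <= \sum_(i <- r) mnorm (f i).
Proof.
elim/big_ind2 : _ => [|x y z t xy zt|//]; first by rewrite mnorm0.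
by apply: le_trans (mnormD _ _) _; exact: lerD.
Qed.

(** The factor is needed already for [j = 0]: the entrywise norm of the identity
    is its size, not one. *)
Lemma mnormX p (A : 'M[K]_p) j : mnorm (A ^+ j) <= mnorm (1%:M : 'M[K]_p) * mnorm A ^+ j.
Proof.
elim: j => [|j IH]; first by rewrite !expr0 mulr1.
rewrite exprSr [X in _ <= _ * X]exprSr mulrA; apply: le_trans (mnormM _ _) _.
by apply: ler_wpM2r => //; exact: mnorm_ge0.
Qed.

Definition rscal p q (t : R) (A : 'M[K]_(p, q)) : 'M[K]_(p, q) := of_real k t *: A.

Lemma mnorm_rscal p q t (A : 'M[K]_(p, q)) : mnorm (rscal t A) = `|t| * mnorm A.
Proof. by rewrite mnormZ modulus_of_real. Qed.

Lemma rscalA p q s t (A : 'M[K]_(p, q)) : rscal s (rscal t A) = rscal (s * t) A.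
Proof. by rewrite /rscal scalerA of_realM. Qed.

Lemma rscal0 p q (A : 'M[K]_(p, q)) : rscal 0 A = 0.
Proof. by rewrite /rscal of_real0 scale0r. Qed.

Lemma rscal1 p q (A : 'M[K]_(p, q)) : rscal 1 A = A.
Proof. by rewrite /rscal of_real1 scale1r. Qed.

Lemma rscalr0 p q t : rscal t (0 : 'M[K]_(p, q)) = 0.
Proof. exact: scaler0. Qed.

Lemma rscalDr p q t (A B : 'M[K]_(p, q)) : rscal t (A + B) = rscal t A + rscal t B.
Proof. exact: scalerDr. Qed.

Lemma rscalBr p q t (A B : 'M[K]_(p, q)) : rscal t (A - B) = rscal t A - rscal t B.
Proof. exact: scalerBr. Qed.

Lemma rscalMl p q r t (A : 'M[K]_(p, q)) (B : 'M[K]_(q, r)) :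
  rscal t A *m B = rscal t (A *m B).
Proof. by rewrite /rscal scalemxAl. Qed.

Lemma rscalMr p q r t (A : 'M[K]_(p, q)) (B : 'M[K]_(q, r)) :
  A *m rscal t B = rscal t (A *m B).
Proof. by rewrite /rscal scalemxAr. Qed.

Lemma rscalK p q t (A : 'M[K]_(p, q)) : t != 0 -> rscal t (rscal t^-1 A) = A.
Proof. by move=> t0; rewrite rscalA divff// rscal1. Qed.

Lemma rscalVK p q t (A : 'M[K]_(p, q)) : t != 0 -> rscal t^-1 (rscal t A) = A.
Proof. by move=> t0; rewrite rscalA mulVf// rscal1. Qed.

(** Convergence to [Z] along [F].  Unlike convergence for the topology of
    matrices, with which it agrees by [cvg_mtends], it is estimated by real
    numbers whatever the scalars. *)
Definition mtends (T : Type) (F : set_system T) p q (u : T -> 'M[K]_(p, q)) Z :=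
  mnorm (u x - Z) @[x --> F] --> (0 : R).

Section Convergence.
Variables (T : Type) (F : set_system T).
Context {FF : Filter F}.

Lemma mtends_cst p q (Z : 'M[K]_(p, q)) : mtends F (fun=> Z) Z.
Proof. by rewrite /mtends subrr mnorm0; exact: cvg_cst. Qed.

Lemma mtends_bound p q (u : T -> 'M[K]_(p, q)) Z (h : T -> R) :
  (\forall x \near F, mnorm (u x - Z) <= h x) -> h x @[x --> F] --> (0 : R) ->
  mtends F u Z.
Proof.
move=> uh h0; apply: squeeze_cvg0 h0; apply: filterS uh => x ->.
by rewrite mnorm_ge0.
Qed.

Lemma mtends_near p q (u v : T -> 'M[K]_(p, q)) Z :
  (\forall x \near F, u x = v x) -> mtends F u Z -> mtends F v Z.
Proof.
move=> uv uZ; apply: mtends_bound uZ; apply: filterS uv => x ->; exact: lexx.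
Qed.

Lemma mtendsD p q (u v : T -> 'M[K]_(p, q)) Z W :
  mtends F u Z -> mtends F v W -> mtends F (fun x => u x + v x) (Z + W).
Proof.
move=> uZ vW; apply: (mtends_bound (h := fun x => mnorm (u x - Z) + mnorm (v x - W))).
  by apply: nearW => x; rewrite opprD addrACA mnormD.
by rewrite -[X in _ --> X]addr0; exact: cvgD.
Qed.

Lemma mtendsN p q (u : T -> 'M[K]_(p, q)) Z :
  mtends F u Z -> mtends F (fun x => - u x) (- Z).
Proof.
move=> uZ; apply: mtends_bound uZ; apply: nearW => x.
by rewrite -opprD mnormN.
Qed.

Lemma mtendsB p q (u v : T -> 'M[K]_(p, q)) Z W :
  mtends F u Z -> mtends F v W -> mtends F (fun x => u x - v x) (Z - W).
Proof. by move=> uZ vW; apply: mtendsD => //; exact: mtendsN. Qed.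

Lemma mtendsM p q r (u : T -> 'M[K]_(p, q)) (v : T -> 'M[K]_(q, r)) Z W :
  mtends F u Z -> mtends F v W -> mtends F (fun x => u x *m v x) (Z *m W).
Proof.
move=> uZ vW; pose a x := mnorm (u x - Z); pose b x := mnorm (v x - W).
apply: (mtends_bound (h := fun x => a x * b x + (a x * mnorm W + mnorm Z * b x))).
  apply: nearW => x.
  have -> : u x *m v x - Z *m W =
      (u x - Z) *m (v x - W) + ((u x - Z) *m W + Z *m (v x - W)).
    rewrite -{1}(subrK Z (u x)) -{1}(subrK W (v x)).
    by move: (u x - Z) (v x - W) => c d; rewrite mulmxDl !mulmxDr addrA addrK addrA.
  apply: le_trans (mnormD _ _) (lerD (mnormM _ _) _).
  exact: le_trans (mnormD _ _) (lerD (mnormM _ _) (mnormM _ _)).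
rewrite -[X in _ --> X]addr0; apply: cvgD; first by rewrite -[X in _ --> X](mulr0 0); exact: cvgM.
rewrite -[X in _ --> X]addr0; apply: cvgD.
  by rewrite -[X in _ --> X](mul0r (mnorm W)); apply: cvgMr_tmp.
by rewrite -[X in _ --> X](mulr0 (mnorm Z)); apply: cvgMl_tmp.
Qed.

Lemma mtends_near_bound p q (u : T -> 'M[K]_(p, q)) Z :
  mtends F u Z -> \forall x \near F, mnorm (u x) <= mnorm Z + 1.
Proof.
move=> /cvgr0Pnorm_le /(_ 1 ltr01); apply: filterS => x.
rewrite ger0_norm ?mnorm_ge0// => h; rewrite -[u x](subrK Z) addrC.
by apply: le_trans (mnormD _ _) _; rewrite lerD2l.
Qed.

Lemma mtends_comp (S : Type) (G : set_system S) (h : S -> T) p q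
    (u : T -> 'M[K]_(p, q)) Z :
  h x @[x --> G] `=>` F -> mtends F u Z -> mtends G (u \o h) Z.
Proof. by move=> hG uZ; exact: (cvg_comp _ _ hG uZ). Qed.

End Convergence.

Lemma mtends_sub (T : Type) (F G : set_system T) p q (u : T -> 'M[K]_(p, q)) Z :
  F `<=` G -> mtends F u Z -> mtends G u Z.
Proof. by move=> FG uZ A /uZ; exact: FG. Qed.

Lemma mtends_norm (T : Type) (F : set_system T) {FF : Filter F} p q
    (u : T -> 'M[K]_(p, q)) Z :
  mtends F u Z -> mnorm (u x) @[x --> F] --> mnorm Z.
Proof.
move=> uZ; apply/cvgrPdist_le => e e0.
move/cvgr0Pnorm_le : uZ => /(_ e e0); apply: filterS => x.
rewrite ger0_norm ?mnorm_ge0// => h; apply: le_trans h.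
rewrite ler_norml lerNl opprB !lerBlDr; apply/andP; split.
  by rewrite -{1}[u x](subrK Z) mnormD.
by rewrite -{1}[Z](subrK (u x)) mnorm_distC mnormD.
Qed.

Lemma mtends_unique (T : Type) (F : set_system T) {FF : ProperFilter F} p q
    (u : T -> 'M[K]_(p, q)) Z W :
  mtends F u Z -> mtends F u W -> Z = W.
Proof.
move=> uZ uW; apply/eqP; rewrite -subr_eq0; apply/eqP/mnorm0_eq0.
have h : mtends F (fun x => u x - u x) (Z - W) by exact: mtendsB.
have : mnorm (u x - u x) @[x --> F] --> mnorm (Z - W) by exact: mtends_norm.
under eq_fun do rewrite subrr mnorm0.
by move=> h0; exact: (norm_cvg_unique h0 (cvg_cst (0 : R))).
Qed.

Lemma cvg0_sum (T I : Type) (F : set_system T) {FF : Filter F} (r : seq I)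
    (f : I -> T -> R) :
  (forall i, f i x @[x --> F] --> (0 : R)) ->
  \sum_(i <- r) f i x @[x --> F] --> (0 : R).
Proof.
move=> f0; elim: r => [|i r IH].
  by under eq_fun do rewrite big_nil; exact: cvg_cst.
under eq_fun do rewrite big_cons.
have : f i x + \sum_(j <- r) f j x @[x --> F] --> 0 + (0 : R) by exact: cvgD.
by rewrite addr0.
Qed.

Lemma mtendsP (T : Type) (F : set_system T) {FF : Filter F} p q
    (u : T -> 'M[K]_(p, q)) Z :
  mtends F u Z <-> forall i j, modulus (u x i j - Z i j) @[x --> F] --> (0 : R).
Proof.
split=> [uZ i j|uZ].
  apply: squeeze_cvg0 uZ; apply: nearW => x; rewrite modulus_ge0 /=.
  by apply: le_trans (modulus_le_mnorm _ i j); rewrite !mxE.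
apply: (mtends_bound (h := fun x => \sum_i \sum_j modulus (u x i j - Z i j))).
  apply: nearW => x; rewrite le_eqVlt; apply/orP; left; apply/eqP.
  by apply: eq_bigr => i _; apply: eq_bigr => j _; rewrite !mxE.
by apply: cvg0_sum => i; apply: cvg0_sum => j.
Qed.

Lemma ultra_mtends (T : Type) (U : set_system T) p q (u : T -> 'M[K]_(p, q)) (B : R) :
  UltraFilter U -> (\forall x \near U, mnorm (u x) <= B) ->
  exists Z, mtends U u Z.
Proof.
move=> UU uB; have PU : ProperFilter U by exact: ultra_proper.
have H i j : exists z, modulus (u x i j - z) @[x --> U] --> (0 : R).
  apply: ultra_modulus_bounded; apply: filterS uB => x; apply: le_trans.
  exact: modulus_le_mnorm.
pose Z i j := sval (cid (H i j)).
exists (\matrix_(i, j) Z i j); apply/mtendsP => i j; rewrite mxE.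
exact: (svalP (cid (H i j))).
Qed.

Lemma cvg_modulus (T : Type) (F : set_system T) {FF : Filter F} (f : T -> K) (z : K) :
  f x @[x --> F] --> z <-> modulus (f x - z) @[x --> F] --> (0 : R).
Proof.
split=> [/cvgrPdist_lt fz|fz].
  apply/cvgr0Pnorm_lt => e e0; have e0' : 0 < of_real k e by rewrite -of_real0 of_real_lt.
  have := fz _ e0'; apply: filterS => x; rewrite normr_modulus of_real_lt.
  by rewrite -modulusN opprB ger0_norm ?modulus_ge0.
apply/cvgrPdist_lt => e /pos_of_real [d d0 ->].
move/cvgr0Pnorm_lt : fz => /(_ d d0); apply: filterS => x.
by rewrite ger0_norm ?modulus_ge0// normr_modulus of_real_lt -modulusN opprB.
Qed.

Lemma mnorm_ball p q (A B : 'M[K]_(p, q)) (e : R) :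
  mnorm (A - B) < e -> ball A (of_real k e) B.
Proof.
move=> AB; split; first by rewrite -of_real0 of_real_lt (le_lt_trans (mnorm_ge0 _) AB).
move=> i j; apply/ball_modulus; apply: le_lt_trans AB.
by apply: le_trans (modulus_le_mnorm _ i j); rewrite !mxE.
Qed.

Lemma cvg_mtends (T : Type) (F : set_system T) {FF : Filter F} p q
    (u : T -> 'M[K]_(p, q)) Z :
  u x @[x --> F] --> Z <-> mtends F u Z.
Proof.
split=> [uZ|uZ].
  apply/mtendsP => i j; apply/cvgr0Pnorm_lt => e e0.
  have e0' : 0 < of_real k e by rewrite -of_real0 of_real_lt.
  have := uZ _ (nbhsx_ballx Z _ e0').
  apply: (@filterS _ F) => x /= [_ /(_ i j) /ball_modulus].
  by rewrite ger0_norm ?modulus_ge0// -modulusN opprB.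
move=> A /nbhs_ballP [e /= /pos_of_real [d d0 ->] sA].
move/cvgr0Pnorm_lt : uZ => /(_ d d0); apply: filterS => x h; apply: sA.
by apply: mnorm_ball; rewrite mnorm_distC; rewrite ger0_norm ?mnorm_ge0 in h.
Qed.

Lemma mtends_nbhs p q (Z : 'M[K]_(p, q)) : mtends (nbhs Z) id Z.
Proof. by apply/cvg_mtends. Qed.

End MatrixNorm.

(** * The matrix exponential *)

Section MatrixExponential.
Variables (R : realType) (k : scalar_kind).
Local Notation K := (scalar_field R k).

(** The same series as [mexp], for real scalars as well. *)
Definition expm p (X : 'M[K]_p) : 'M[K]_p :=
  lim (series (fun j : nat => (j`!%:R)^-1 *: X ^+ j) @ \oo).

Definition expsum p (X : 'M[K]_p) : nat -> 'M[K]_p :=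
  series (fun j : nat => (j`!%:R)^-1 *: X ^+ j).

Local Notation size1 p := (mnorm (1%:M : 'M[K]_p)).

Lemma expsum_dist p (X : 'M[K]_p) m n : (m <= n)%N ->
  mnorm (expsum X n - expsum X m) <=
    size1 p * (series (exp_coeff (mnorm X)) n - series (exp_coeff (mnorm X)) m).
Proof.
move=> mn; rewrite /expsum /series /= [X in X - _](big_cat_nat _ mn)//=.
rewrite [X in _ <= _ * (X - _)](big_cat_nat _ mn)//=.
rewrite [X in mnorm (X - _)]addrC addrK [X in _ <= _ * (X - _)]addrC addrK.
apply: le_trans (mnorm_sum _ _) _; rewrite mulr_sumr.
apply: ler_sum => j _; rewrite mnormZ -of_real_nat -of_realV modulus_of_real.
rewrite ger0_norm ?invr_ge0// /exp_coeff /= [_ / _]mulrC mulrCA.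
by apply: ler_wpM2l; rewrite ?invr_ge0// mnormX.
Qed.

Lemma exp_partial_le (a : R) m : 0 <= a -> series (exp_coeff a) m <= expR a.
Proof.
move=> a0; apply: nondecreasing_cvgn_le; last exact: is_cvg_series_exp_coeff.
by apply/nondecreasing_seqP => j; rewrite /series /= big_nat_recr//= lerDl exp_coeff_ge0.
Qed.

(** The tails of the series are dominated by those of the real exponential of
    the norm, so a limit along an ultrafilter is a limit, with the same bound. *)
Lemma expm_dist_exists p (X : 'M[K]_p) : exists E, forall m,
  mnorm (E - expsum X m) <= size1 p * (expR (mnorm X) - series (exp_coeff (mnorm X)) m).
Proof.
have c0 : 0 <= size1 p by exact: mnorm_ge0.
have D m n : (m <= n)%N -> mnorm (expsum X n - expsum X m) <=
    size1 p * (expR (mnorm X) - series (exp_coeff (mnorm X)) m).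
  move=> mn; apply: le_trans (expsum_dist X mn) _; apply: ler_wpM2l => //.
  by rewrite lerD2r exp_partial_le ?mnorm_ge0.
have [U [UU sU]] := @ultraFilterLemma nat \oo _.
have PU : ProperFilter U by exact: ultra_proper.
have [|E UE] := @ultra_mtends R k _ U _ _ (expsum X) (size1 p * expR (mnorm X)) UU.
  apply: nearW => m; have := D 0%N m (leq0n m).
  have -> : expsum X 0 = 0 by rewrite /expsum /series /= big_geq.
  by rewrite [series _ 0%N]/series /= big_geq// !subr0.
exists E => m.
have h : mtends U (fun n => expsum X n - expsum X m) (E - expsum X m).
  by apply: mtendsB => //; exact: mtends_cst.
have {h} : mnorm (expsum X n - expsum X m) @[n --> U] --> mnorm (E - expsum X m).
  exact: mtends_norm.
move/cvgr_to_le; apply; apply: sU; exists m => // n /= mn; exact: D.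
Qed.

Lemma exp_partial_cvg (a : R) : series (exp_coeff a) n @[n --> \oo] --> expR a.
Proof. exact: is_cvg_series_exp_coeff. Qed.

Lemma expsum_tends_dist p (X : 'M[K]_p) E :
  (forall m, mnorm (E - expsum X m) <=
     size1 p * (expR (mnorm X) - series (exp_coeff (mnorm X)) m)) ->
  mtends \oo (expsum X) E.
Proof.
move=> ED; apply: (mtends_bound (h := fun m =>
    size1 p * (expR (mnorm X) - series (exp_coeff (mnorm X)) m))).
  by apply: nearW => m; rewrite mnorm_distC.
have : size1 p * (expR (mnorm X) - series (exp_coeff (mnorm X)) m) @[m --> \oo] -->
    size1 p * (expR (mnorm X) - expR (mnorm X)).
  by apply: cvgMl_tmp; apply: cvgB; [exact: cvg_cst|exact: exp_partial_cvg].
by rewrite subrr mulr0.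
Qed.

Lemma expm_dist p (X : 'M[K]_p) m :
  mnorm (expm X - expsum X m) <=
    size1 p * (expR (mnorm X) - series (exp_coeff (mnorm X)) m).
Proof.
have [E ED] := expm_dist_exists X; suff -> : expm X = E by exact: ED.
by apply: cvg_lim => //; apply/cvg_mtends; exact: expsum_tends_dist.
Qed.

Lemma expsum_tends p (X : 'M[K]_p) : mtends \oo (expsum X) (expm X).
Proof. by apply: expsum_tends_dist => m; exact: expm_dist. Qed.

Lemma expm_near1 p (X : 'M[K]_p) :
  mnorm (expm X - 1%:M) <= size1 p * (expR (mnorm X) - 1).
Proof.
have := expm_dist X 1; rewrite /expsum /series /= !big_nat1.
by rewrite expr0 fact0 invr1 scale1r /exp_coeff /= expr0 fact0 divr1.
Qed.

Lemma expm_near2 p (X : 'M[K]_p) :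
  mnorm (expm X - 1%:M - X) <= size1 p * (expR (mnorm X) - 1 - mnorm X).
Proof.
have := expm_dist X 2; rewrite /expsum /series /= !(big_nat_recr 1)//= !big_nat1.
rewrite !expr0 !expr1 fact0 invr1 !scale1r /exp_coeff /= !expr0 fact0 divr1.
by rewrite expr1 (factS 0) fact0 muln1 mulr1n divr1 !opprD !addrA.
Qed.

(** The terms of the Cauchy product of two partial sums: those of total degree
    less than [n], grouped by degree, and the remaining ones. *)
Lemma sum_square_split (V : zmodType) (f : nat -> nat -> V) n :
  \sum_(0 <= i < n) \sum_(0 <= j < n) f i j =
  \sum_(0 <= m < n) \sum_(0 <= i < m.+1) f i (m - i)%N +
  \sum_(0 <= i < n) \sum_(n - i <= j < n) f i j.
Proof.
have -> : \sum_(0 <= m < n) \sum_(0 <= i < m.+1) f i (m - i)%N =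
    \sum_(0 <= i < n) \sum_(0 <= j < n - i) f i j.
  elim: n => [|n IH]; first by rewrite !big_geq.
  rewrite !big_nat_recr//= IH subSnn big_nat1 subnn addrA -big_split /=.
  congr (_ + _); rewrite !big_nat; apply: eq_bigr => i /andP[_ ltin].
  by rewrite (subSn (ltnW ltin)) big_nat_recr.
rewrite -big_split /=; apply: eq_bigr => i _.
by rewrite -big_cat_nat// leq_subr.
Qed.

Lemma binomial_fact (s t : R) m :
  \sum_(0 <= i < m.+1) (s ^+ i / i`!%:R) * (t ^+ (m - i) / (m - i)`!%:R) =
  (s + t) ^+ m / m`!%:R.
Proof.
rewrite addrC exprDn big_mkord mulr_suml; apply: eq_bigr => i _.
have im : (i <= m)%N by rewrite -ltnS.
have f0 j : (j`!%:R : R) != 0 by rewrite pnatr_eq0 -lt0n fact_gt0.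
rewrite -(bin_fact im) !natrM -mulr_natr; field.
by rewrite !f0 pnatr_eq0 -lt0n bin_gt0 im.
Qed.

Lemma expsum_rscal p (X : 'M[K]_p) t n :
  expsum (rscal t X) n = \sum_(0 <= i < n) rscal (t ^+ i / i`!%:R) (X ^+ i).
Proof.
apply: eq_bigr => i _; rewrite /rscal of_realM of_realV of_real_nat of_realX.
rewrite mulrC -scalerA; congr (_ *: _); elim: i => [|i IH].
  by rewrite !expr0 scale1r.
have exprSmx (Y : 'M[K]_p) : Y ^+ i.+1 = Y *m Y ^+ i by rewrite exprS.
by rewrite !exprSmx IH exprS -scalemxAl -scalemxAr scalerA.
Qed.

Lemma mulmxX p (X : 'M[K]_p) i j : X ^+ i *m X ^+ j = X ^+ (i + j).
Proof. by rewrite exprD. Qed.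

(** The failure of the partial sums to be multiplicative is dominated by its
    real counterpart, which vanishes in the limit because the real exponential
    is multiplicative. *)
Lemma expmD p (X : 'M[K]_p) s t :
  expm (rscal s X) *m expm (rscal t X) = expm (rscal (s + t) X).
Proof.
set a := mnorm X.
pose S u := series (exp_coeff (u * a)).
pose f i j := rscal (s ^+ i / i`!%:R * (t ^+ j / j`!%:R)) (X ^+ (i + j)).
pose g i j : R := ((`|s| * a) ^+ i / i`!%:R) * ((`|t| * a) ^+ j / j`!%:R).
have E n : expsum (rscal s X) n *m expsum (rscal t X) n - expsum (rscal (s + t) X) n =
    \sum_(0 <= i < n) \sum_(n - i <= j < n) f i j.
  rewrite !expsum_rscal mulmx_suml.
  under eq_bigr => i _.
    rewrite mulmx_sumr; under eq_bigr => j _ do rewrite rscalMl rscalMr rscalA mulmxX.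
  over.
  rewrite (sum_square_split f) [X in X - _]addrC -addrA -[RHS]addr0; congr (_ + _).
  apply/eqP; rewrite subr_eq0; apply/eqP; apply: eq_bigr => m _.
  rewrite -binomial_fact /rscal; under eq_big_nat => i /andP[_ im].
    rewrite /f subnKC//; over.
  by rewrite -scaler_suml; congr (_ *: _); elim/big_ind2 : _ => [|x y z w -> ->|//];
    rewrite ?of_real0 ?of_realD.
have G n : S `|s| n * S `|t| n - S (`|s| + `|t|) n =
    \sum_(0 <= i < n) \sum_(n - i <= j < n) g i j.
  have -> : S `|s| n * S `|t| n = \sum_(0 <= i < n) \sum_(0 <= j < n) g i j.
    by rewrite /S /series /= mulr_suml; apply: eq_bigr => i _; rewrite mulr_sumr.
  rewrite /S /series /= (sum_square_split g) [X in X - _]addrC -addrA -[RHS]addr0; congr (_ + _).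
  apply/eqP; rewrite subr_eq0; apply/eqP; apply: eq_bigr => m _.
  by rewrite /g binomial_fact mulrDl.
apply: (@mtends_unique R k _ \oo _ _ _
  (fun n => expsum (rscal s X) n *m expsum (rscal t X) n)).
  by apply: mtendsM; exact: expsum_tends.
rewrite -[expm _]addr0.
apply: (@mtends_near R k _ \oo _ _ _ (fun n => expsum (rscal (s + t) X) n +
    (expsum (rscal s X) n *m expsum (rscal t X) n - expsum (rscal (s + t) X) n))).
  by apply: nearW => n; rewrite addrC subrK.
apply: mtendsD; first exact: expsum_tends.
apply: (mtends_bound (h := fun n => size1 p *
    (S `|s| n * S `|t| n - S (`|s| + `|t|) n))).
  apply: nearW => n; rewrite subr0 E G.
  apply: le_trans (mnorm_sum _ _) _; rewrite mulr_sumr; apply: ler_sum => i _.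
  apply: le_trans (mnorm_sum _ _) _; rewrite mulr_sumr; apply: ler_sum => j _.
  rewrite mnorm_rscal !normrM !normfV !normrX !normr_nat.
  have -> : size1 p * g i j = `|s| ^+ i / i`!%:R * (`|t| ^+ j / j`!%:R) *
      (size1 p * a ^+ (i + j)) by rewrite /g !exprMn exprD; ring.
  apply: ler_wpM2l; last exact: mnormX.
  by rewrite !mulr_ge0 ?invr_ge0 ?exprn_ge0.
have : size1 p * (S `|s| n * S `|t| n - S (`|s| + `|t|) n) @[n --> \oo] -->
    size1 p * (expR (`|s| * a) * expR (`|t| * a) - expR ((`|s| + `|t|) * a)).
  apply: cvgMl_tmp; apply: cvgB; last exact: exp_partial_cvg.
  by apply: cvgM; exact: exp_partial_cvg.
by rewrite mulrDl expRD subrr mulr0.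
Qed.

End MatrixExponential.

Lemma mexp_expm (R : realType) n (X : 'M[scalar_field R Complexes]_n) : mexp X = expm X.
Proof. by []. Qed.

(* Unification must not unfold the exponential into its series. *)
#[global] Opaque expm.

(** * One-parameter subgroups and iterated curves *)

Section OneParameter.
Variables (R : realType) (k : scalar_kind).
Local Notation K := (scalar_field R k).
Local Notation size1 p := (mnorm (1%:M : 'M[K]_p)).

Lemma expm0 p (X : 'M[K]_p) : expm (rscal 0 X) = 1%:M.
Proof.
apply/eqP; rewrite -subr_eq0; apply/eqP/mnorm0_eq0/eqP.
rewrite eq_le mnorm_ge0 andbT; apply: le_trans (expm_near1 _) _.
by rewrite rscal0 mnorm0 expR0 subrr mulr0.
Qed.

Lemma expmNV p (X : 'M[K]_p) t : expm (rscal (- t) X) *m expm (rscal t X) = 1%:M.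
Proof. by rewrite expmD addNr expm0. Qed.

Lemma expmVN p (X : 'M[K]_p) t : expm (rscal t X) *m expm (rscal (- t) X) = 1%:M.
Proof. by rewrite expmD addrN expm0. Qed.

Lemma expm_unit p (X : 'M[K]_p) t : expm (rscal t X) \in unitmx.
Proof. by case/mulmx1_unit : (expmVN X t). Qed.

Lemma expm_inv p (X : 'M[K]_p) t : invmx (expm (rscal t X)) = expm (rscal (- t) X).
Proof.
by rewrite -[LHS]mulmx1 -(expmVN X t) mulmxA mulVmx ?mul1mx// expm_unit.
Qed.

Lemma expmX p (X : 'M[K]_p) t m : expm (rscal t X) ^+ m = expm (rscal (m%:R * t) X).
Proof.
elim: m => [|m IH]; first by rewrite expr0 mul0r expm0.
have -> : expm (rscal t X) ^+ m.+1 = expm (rscal t X) *m expm (rscal t X) ^+ m.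
  by rewrite exprS.
by rewrite IH expmD -natr1 mulrDl mul1r addrC.
Qed.

(** From [expR x * (1 - x) <= 1]. *)
Lemma expR_quadratic (x : R) : 0 <= x -> x <= 2^-1 -> expR x - 1 - x <= 2 * x ^+ 2.
Proof.
move=> x0 x2; have x1 : 0 < 1 - x by lra.
have h : expR x * (1 - x) <= 1.
  have h2 : expR x * expR (- x) = 1 by rewrite -expRD subrr expR0.
  rewrite -[leRHS]h2; apply: ler_wpM2l; first exact: expR_ge0.
  exact: expR_ge1Dx.
have := expR_gt0 x; nra.
Qed.

Section Filters.
Variables (T : Type) (F : set_system T).
Context {FF : Filter F}.

Lemma expm_cvg1 p (X : 'M[K]_p) (s : T -> R) :
  s x @[x --> F] --> (0 : R) -> mtends F (fun x => expm (rscal (s x) X)) 1%:M.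
Proof.
move=> s0; apply: (mtends_bound (h := fun x =>
    size1 p * (expR (`|s x| * mnorm X) - 1))).
  by apply: nearW => x; rewrite -mnorm_rscal expm_near1.
have : size1 p * (expR (`|s x| * mnorm X) - 1) @[x --> F] -->
   size1 p * (expR (`|0 : R| * mnorm X) - 1).
  apply: cvgMl_tmp; apply: cvgB; last exact: cvg_cst.
  apply: continuous_cvg; first exact: continuous_expR.
  by apply: cvgMr_tmp; exact: cvg_norm.
by rewrite normr0 mul0r expR0 subrr mulr0.
Qed.

Lemma expm_cvg p (X : 'M[K]_p) (s : T -> R) t :
  s x @[x --> F] --> t ->
  mtends F (fun x => expm (rscal (s x) X)) (expm (rscal t X)).
Proof.
move=> st; have st0 : s x - t @[x --> F] --> (0 : R).
  by rewrite -(subrr t); apply: cvgB => //; exact: cvg_cst.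
rewrite -[expm (rscal t X)]mulmx1.
apply: (mtends_near (u := fun x => expm (rscal t X) *m expm (rscal (s x - t) X))).
  by apply: nearW => x; rewrite expmD addrC subrK.
by apply: mtendsM; [exact: mtends_cst|exact: expm_cvg1].
Qed.

Lemma expm_tangent p (X : 'M[K]_p) (s : T -> R) :
  s x @[x --> F] --> (0 : R) -> (\forall x \near F, s x != 0) ->
  mtends F (fun x => rscal (s x)^-1 (expm (rscal (s x) X) - 1%:M)) X.
Proof.
move=> s0 sn0; set a := mnorm X.
have as0 : `|s x| * a @[x --> F] --> (0 : R).
  rewrite -[X in _ --> X](mul0r a); apply: cvgMr_tmp.
  by rewrite -[X in _ --> X](normr0 R); exact: cvg_norm.
apply: (mtends_bound (h := fun x => size1 p * (2 * a * (`|s x| * a)))).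
  move/cvgr0Pnorm_le : as0 => /(_ 2^-1); rewrite invr_gt0 ltr0n => /(_ isT).
  move: sn0; apply: filterS2 => x sx sa.
  have sx0 : 0 < `|s x| by rewrite normr_gt0.
  have a0 : 0 <= a by exact: mnorm_ge0.
  have sa0 : 0 <= `|s x| * a by rewrite mulr_ge0.
  rewrite (ger0_norm sa0) in sa.
  rewrite -{2}(rscalVK X sx) -rscalBr mnorm_rscal normfV.
  rewrite -(ler_pM2l sx0) mulVKf ?gt_eqF//.
  apply: le_trans (expm_near2 _) _; rewrite mnorm_rscal -/a.
  have -> : `|s x| * (size1 p * (2 * a * (`|s x| * a))) =
    size1 p * (2 * (`|s x| * a) ^+ 2) by ring.
  by apply: ler_wpM2l; [exact: mnorm_ge0|exact: expR_quadratic].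
have : size1 p * (2 * a * (`|s x| * a)) @[x --> F] --> size1 p * (2 * a * 0).
  by apply: cvgMl_tmp; apply: cvgMl_tmp.
by rewrite !mulr0.
Qed.

(** Telescoping [A ^+ m - B ^+ m] into [m] terms containing one factor
    [A - B] each. *)
Lemma mnorm_subX p (A B : 'M[K]_p) d m :
  mnorm (A - 1%:M) <= d -> mnorm (B - 1%:M) <= d ->
  mnorm (A ^+ m - B ^+ m) <= m%:R * size1 p * (1 + d) ^+ m * mnorm (A - B).
Proof.
move=> Ad Bd; have d0 : 0 <= d by apply: le_trans Ad; exact: mnorm_ge0.
have c0 : 0 <= size1 p by exact: mnorm_ge0.
have e0 : 0 <= mnorm (A - B) by exact: mnorm_ge0.
have pd j : 0 <= (1 + d) ^+ j by rewrite exprn_ge0// addr_ge0.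
have exSr (Y : 'M[K]_p) j : Y ^+ j.+1 = Y ^+ j *m Y by rewrite exprSr.
have mulD (C D : 'M[K]_p) : mnorm (D - 1%:M) <= d -> mnorm (C *m D) <= mnorm C * (1 + d).
  move=> Dd; rewrite -[D](subrK 1%:M) mulmxDr mulmx1 addrC.
  apply: le_trans (mnormD _ _) _; rewrite mulrDr mulr1 lerD2l.
  apply: le_trans (mnormM _ _) _; apply: ler_wpM2l => //; exact: mnorm_ge0.
have pA j : mnorm (A ^+ j) <= size1 p * (1 + d) ^+ j.
  elim: j => [|j IH]; first by rewrite !expr0 mulr1.
  rewrite exSr; apply: le_trans (mulD _ _ Ad) _; rewrite exprSr mulrA.
  by apply: ler_wpM2r => //; rewrite addr_ge0.
elim: m => [|m IH]; first by rewrite !expr0 subrr mnorm0 !mul0r.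
have -> : A ^+ m.+1 - B ^+ m.+1 = A ^+ m *m (A - B) + (A ^+ m - B ^+ m) *m B.
  by rewrite !exSr mulmxBr mulmxBl addrA subrK.
apply: le_trans (mnormD _ _) _.
have h1 : mnorm (A ^+ m *m (A - B)) <= size1 p * (1 + d) ^+ m.+1 * mnorm (A - B).
  apply: le_trans (mnormM _ _) _; apply: ler_wpM2r => //.
  apply: le_trans (pA m) _; apply: ler_wpM2l => //.
  by rewrite exprSr ler_peMr// lerDl.
have h2 : mnorm ((A ^+ m - B ^+ m) *m B) <=
    m%:R * size1 p * (1 + d) ^+ m.+1 * mnorm (A - B).
  apply: le_trans (mulD _ _ Bd) _; rewrite exprSr.
  have -> : m%:R * size1 p * ((1 + d) ^+ m * (1 + d)) * mnorm (A - B) =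
    m%:R * size1 p * (1 + d) ^+ m * mnorm (A - B) * (1 + d) by ring.
  by apply: ler_wpM2r => //; rewrite addr_ge0.
by apply: le_trans (lerD h1 h2) _; rewrite -natr1 !mulrDl mul1r addrC.
Qed.

(** The curve [u] and the exponential [expm (rscal tau Z)] have the same tangent,
    so they differ by [tau * eta] with [eta] tending to zero; taking about
    [t / tau] powers multiplies this error by at most a constant times
    [t / tau], and the powers of the exponential tend to [expm (rscal t Z)]. *)
Lemma power_limit p (u : T -> 'M[K]_p) (tau : T -> R) Z t :
  0 <= t -> (\forall x \near F, 0 < tau x) -> tau x @[x --> F] --> (0 : R) ->
  mtends F (fun x => rscal (tau x)^-1 (u x - 1%:M)) Z ->
  (Num.trunc (t / tau x))%:R * tau x @[x --> F] --> t /\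
  mtends F (fun x => u x ^+ Num.trunc (t / tau x)) (expm (rscal t Z)).
Proof.
move=> t0 tau_gt0 tau0 uZ; set m := fun x => Num.trunc (t / tau x).
have mt : \forall x \near F, (m x)%:R * tau x <= t < (m x)%:R * tau x + tau x.
  move: tau_gt0; apply: filterS => x tx.
  have := @truncn_itv R (t / tau x) (divr_ge0 t0 (ltW tx)).
  by rewrite ler_pdivlMr// ltr_pdivrMr// -natr1 mulrDl mul1r.
have mtau : (m x)%:R * tau x @[x --> F] --> t.
  have h : t - (m x)%:R * tau x @[x --> F] --> (0 : R).
    apply: squeeze_cvg0 tau0; apply: filterS mt => x /andP[h1 h2].
    by rewrite subr_ge0 h1 lerBlDl (ltW h2).
  have : t - (t - (m x)%:R * tau x) @[x --> F] --> t - 0.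
    by apply: cvgB => //; exact: cvg_cst.
  by rewrite subr0; under eq_fun do rewrite opprB addrC subrK.
split=> //.
have vZ : mtends F (fun x => rscal (tau x)^-1 (expm (rscal (tau x) Z) - 1%:M)) Z.
  by apply: expm_tangent => //; apply: filterS tau_gt0 => x; rewrite lt0r => /andP[].
pose eta x := mnorm (rscal (tau x)^-1 (u x - 1%:M) -
                     rscal (tau x)^-1 (expm (rscal (tau x) Z) - 1%:M)).
have eta0 : eta x @[x --> F] --> (0 : R).
  have : mtends F (fun x => rscal (tau x)^-1 (u x - 1%:M) -
      rscal (tau x)^-1 (expm (rscal (tau x) Z) - 1%:M)) (Z - Z) by exact: mtendsB.
  by move/mtends_norm; rewrite subrr mnorm0.
rewrite -[expm _]addr0.
apply: (mtends_near (u := fun x => expm (rscal (tau x) Z) ^+ m x +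
    (u x ^+ m x - expm (rscal (tau x) Z) ^+ m x))).
  by apply: nearW => x; rewrite addrC subrK.
apply: mtendsD.
  apply: (mtends_near (u := fun x => expm (rscal ((m x)%:R * tau x) Z))).
    by apply: nearW => x; rewrite expmX.
  exact: expm_cvg.
pose C := mnorm Z + 1; have C0 : 0 <= C by rewrite addr_ge0// mnorm_ge0.
apply: (mtends_bound (h := fun x => t * size1 p * expR (C * t) * eta x)); last first.
  have : t * size1 p * expR (C * t) * eta x @[x --> F] --> t * size1 p * expR (C * t) * 0.
    by apply: cvgMl_tmp.
  by rewrite mulr0.
have uB := mtends_near_bound uZ; have vB := mtends_near_bound vZ.
near=> x.
have tx : 0 < tau x by near: x.
have tx0 : tau x != 0 by rewrite gt_eqF.
have dst (A : 'M[K]_p) : mnorm A = tau x * mnorm (rscal (tau x)^-1 A).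
  by rewrite -{1}(rscalK A tx0) mnorm_rscal gtr0_norm.
rewrite subr0; apply: le_trans (@mnorm_subX _ _ _ (C * tau x) _ _ _) _.
- by rewrite dst mulrC ler_pM2r//; near: x; exact: uB.
- by rewrite dst mulrC ler_pM2r//; near: x; exact: vB.
have -> : mnorm (u x - expm (rscal (tau x) Z)) = tau x * eta x.
  rewrite dst /eta -rscalBr; congr (_ * mnorm (rscal _ _)).
  by rewrite opprB addrA subrK.
have /andP[mx1 _] : (m x)%:R * tau x <= t < (m x)%:R * tau x + tau x by near: x.
have -> : (m x)%:R * size1 p * (1 + C * tau x) ^+ m x * (tau x * eta x) =
  ((m x)%:R * tau x) * (size1 p * (1 + C * tau x) ^+ m x) * eta x by ring.
rewrite -(mulrA t); apply: ler_wpM2r; first exact: mnorm_ge0.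
apply: ler_pM => //.
- by rewrite mulr_ge0// ltW.
- by rewrite mulr_ge0 ?mnorm_ge0// exprn_ge0// addr_ge0// mulr_ge0// ltW.
apply: ler_wpM2l; first exact: mnorm_ge0.
apply: (@le_trans _ _ (expR (C * tau x) ^+ m x)).
  by rewrite lerXn2r ?nnegrE ?expR_ge0 ?expR_ge1Dx// addr_ge0// mulr_ge0// ltW.
rewrite -expRM_natl ler_expR mulrCA; exact: ler_wpM2l.
Unshelve. all: by end_near. Qed.

End Filters.

End OneParameter.

(** * Continuous one-parameter groups *)

Section ContinuousOneParameterGroups.
Variables (R : realType) (k : scalar_kind).
Local Notation K := (scalar_field R k).

Lemma at_right0_cvg : t @[t --> (0 : R)^'+] --> (0 : R).
Proof. exact: cvg_at_right_filter cvg_id. Qed.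

Lemma at_right0_gt0 : \forall t \near (0 : R)^'+, 0 < t.
Proof. exact: nbhs_right_gt. Qed.

Lemma expm_tangent0 p (X : 'M[K]_p) :
  mtends ((0 : R)^'+) (fun t => rscal t^-1 (expm (rscal t X) - 1%:M)) X.
Proof.
apply: expm_tangent; first exact: at_right0_cvg.
by apply: filterS at_right0_gt0 => t t0; rewrite gt_eqF.
Qed.

Lemma mulmx_sub1 p (A B : 'M[K]_p) :
  (A - 1%:M) *m (B - 1%:M) = A *m B + (1%:M - (A + B)).
Proof.
rewrite mulmxBl !mulmxBr !mul1mx mulmx1; move: (A *m B) (1%:M : 'M[K]_p) => C i.
by rewrite -addrA; congr (_ + _); rewrite opprB opprD addrCA.
Qed.

Lemma expm_mul_tangent p (X Y : 'M[K]_p) :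
  mtends ((0 : R)^'+)
    (fun s => rscal s^-1 (expm (rscal s X) *m expm (rscal s Y) - 1%:M)) (X + Y).
Proof.
apply: (mtends_near (u := fun s =>
   rscal s^-1 (expm (rscal s X) - 1%:M) *m expm (rscal s Y) +
   rscal s^-1 (expm (rscal s Y) - 1%:M))).
  apply: nearW => s; rewrite rscalMl -rscalDr mulmxBl mul1mx.
  by rewrite addrA subrK.
rewrite -[X in X + _]mulmx1; apply: mtendsD; last exact: expm_tangent0.
by apply: mtendsM; [exact: expm_tangent0|exact: expm_cvg1 at_right0_cvg].
Qed.

(** With [a = exp (sX)] and [b = exp (sY)], the group commutator minus one is
    [ab - ba], that is [(a - 1)(b - 1) - (b - 1)(a - 1)], times a factor tending
    to one. *)
Lemma expm_commutator_tangent p (X Y : 'M[K]_p) :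
  mtends ((0 : R)^'+)
    (fun s => rscal (s ^+ 2)^-1
      (expm (rscal s X) *m expm (rscal s Y) *m
       (expm (rscal (- s) X) *m expm (rscal (- s) Y)) - 1%:M))
    (X *m Y - Y *m X).
Proof.
pose x s := rscal s^-1 (expm (rscal s X) - 1%:M).
pose y s := rscal s^-1 (expm (rscal s Y) - 1%:M).
apply: (mtends_near (u := fun s =>
    (x s *m y s - y s *m x s) *m (expm (rscal (- s) X) *m expm (rscal (- s) Y)))).
  apply: nearW => s; rewrite /x /y.
  have := expmVN X s; have := expmVN Y s.
  move: (expm (rscal s X)) (expm (rscal s Y)) (expm (rscal (- s) X))
    (expm (rscal (- s) Y)) => a b a' b' bb aa.
  have ba : b *m a *m (a' *m b') = 1%:M by rewrite mulmxA -(mulmxA b) aa mulmx1.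
  have -> : a *m b *m (a' *m b') - 1%:M = (a *m b - b *m a) *m (a' *m b').
    by rewrite mulmxBl ba.
  rewrite -[RHS]rscalMl; congr (_ *m _).
  rewrite !rscalMl !rscalMr !rscalA -rscalBr expr2 invfM; congr rscal.
  rewrite !mulmx_sub1; move: (a *m b) (b *m a) => r w.
  rewrite [b + a]addrC; move: (1%:M - (a + b)) => c.
  by rewrite opprD addrACA subrr addr0.
have sN : - s @[s --> (0 : R)^'+] --> (0 : R).
  by rewrite -[X in _ --> X]oppr0; apply: cvgN; exact: at_right0_cvg.
rewrite -[X in mtends _ _ X]mulmx1; apply: mtendsM.
  by apply: mtendsB; apply: mtendsM; exact: expm_tangent0.
by rewrite -[X in mtends _ _ X]mulmx1; apply: mtendsM; exact: expm_cvg1 sN.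
Qed.

Lemma expm_inj p (A B : 'M[K]_p) :
  (forall t, 0 < t -> expm (rscal t A) = expm (rscal t B)) -> A = B.
Proof.
move=> AB; apply: (mtends_unique (expm_tangent0 A)).
apply: mtends_near (expm_tangent0 B).
by apply: filterS at_right0_gt0 => t t0; rewrite AB.
Qed.

(** Along an ultrafilter at [0+] the differences [f t - 1] and [t], both divided
    by [sg t = |f t - 1| + t], converge, say to [B] and [be].  Iterating [f t]
    about [s / sg t] times gives [f (s * be)] on the one hand and
    [expm (rscal s B)] on the other.  Dividing by [sg t] rather than by [t]
    keeps both quotients bounded, and [|B| + be = 1] excludes [be = 0]. *)
Theorem one_parameter_group p (f : R -> 'M[K]_p) :
  f 0 = 1%:M -> (forall s t, f (s + t) = f s *m f t) ->
  (forall t, mtends (nbhs t) f (f t)) ->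
  exists A, forall t, f t = expm (rscal t A).
Proof.
move=> f0 fD fc.
have [U [UU sU]] := @ultraFilterLemma R (0 : R)^'+ _.
have PU : ProperFilter U by exact: ultra_proper.
pose sg t := mnorm (f t - 1%:M) + t.
have tpos : \forall t \near U, 0 < t by apply: sU; exact: at_right0_gt0.
have t0 : t @[t --> U] --> (0 : R) by move=> A /at_right0_cvg; exact: sU.
have sgpos : \forall t \near U, 0 < sg t.
  by apply: filterS tpos => t tp; rewrite ltr_wpDl ?mnorm_ge0.
have f1 : mtends U f 1%:M.
  by rewrite -f0; have := fc 0; apply: mtends_sub; exact: t0.
have sg0 : sg t @[t --> U] --> (0 : R).
  by rewrite -[X in _ --> X]addr0; apply: cvgD.
have [B UB] : exists B, mtends U (fun t => rscal (sg t)^-1 (f t - 1%:M)) B.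
  apply: (@ultra_mtends _ _ _ _ _ _ _ 1) => //.
  move: tpos sgpos; apply: filterS2 => t tp sp.
  rewrite mnorm_rscal gtr0_norm ?invr_gt0// ler_pdivrMl// mulr1.
  by rewrite lerDl ltW.
have [be Ube] : exists b : R, t / sg t @[t --> U] --> b.
  apply: (@ultra_cvg_bounded _ _ _ _ 1) => //.
  move: tpos sgpos; apply: filterS2 => t tp sp.
  rewrite (ger0_norm (divr_ge0 (ltW tp) (ltW sp))) ler_pdivrMr// mul1r.
  by rewrite lerDr mnorm_ge0.
have Bbe : mnorm B + be = 1.
  have h1 : mnorm (rscal (sg t)^-1 (f t - 1%:M)) + t / sg t @[t --> U] --> mnorm B + be.
    by apply: cvgD => //; exact: mtends_norm.
  apply: (norm_cvg_unique h1).
  apply: cvg_near_cst; apply: filterS sgpos => t sp.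
  rewrite mnorm_rscal gtr0_norm ?invr_gt0// mulrC -mulrDl.
  by rewrite -[X in X / _]/(sg t) divff// gt_eqF.
have be0 : 0 <= be.
  apply: (cvgr_to_ge Ube); move: tpos sgpos; apply: filterS2 => t tp sp.
  by rewrite divr_ge0// ltW.
have key s : 0 <= s -> f (s * be) = expm (rscal s B).
  move=> s0; pose m t := Num.trunc (s / sg t).
  have [ms fm] := power_limit s0 sgpos sg0 UB.
  have fX t j : f t ^+ j = f (j%:R * t).
    elim: j => [|j IH]; first by rewrite expr0 mul0r f0.
    have -> : f t ^+ j.+1 = f t *m f t ^+ j by rewrite exprS.
    by rewrite IH -fD -natr1 mulrDl mul1r addrC.
  have mt : (m t)%:R * t @[t --> U] --> s * be.
    have h : (m t)%:R * sg t * (t / sg t) @[t --> U] --> s * be by exact: cvgM.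
    apply: cvg_trans h; apply: near_eq_cvg; apply: filterS sgpos => t sp.
    have sn : sg t != 0 by rewrite gt_eqF.
    by rewrite -mulrA [t / _]mulrC mulVKf.
  apply: (@mtends_unique _ _ _ U _ _ _ (fun t => f t ^+ m t)) => //.
  apply: (mtends_near (u := f \o (fun t => (m t)%:R * t))).
    by apply: nearW => t /=; rewrite fX.
  exact: mtends_comp (fc _).
(* If [be = 0] then [expm (rscal s B) = 1] for all [s], so [B = 0] too. *)
have be_gt0 : 0 < be.
  rewrite lt_neqAle be0 andbT; apply/eqP => be00.
  have B0 : B = 0.
    apply: expm_inj => t tp; rewrite -(key t (ltW tp)) -be00 mulr0 f0.
    by rewrite rscalr0 -(rscal0 B) expm0.
  by move/eqP: Bbe; rewrite B0 mnorm0 -be00 addr0 eq_sym oner_eq0.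
have pos t : 0 <= t -> f t = expm (rscal t (rscal be^-1 B)).
  move=> tp; rewrite rscalA -key ?mulrVK//; last by rewrite divr_ge0.
  by rewrite unitfE gt_eqF.
exists (rscal be^-1 B) => t; have [t0'|t0'] := leP 0 t; first exact: pos.
rewrite -[f t]mulmx1 -(expmNV (rscal be^-1 B) t) mulmxA -(pos (- t)); last by rewrite oppr_ge0 ltW.
by rewrite -fD addrN f0 mul1mx.
Qed.

End ContinuousOneParameterGroups.

(** * The Lie algebra of a closed linear group *)

Section LieGroups.
Variables (R : realType) (n : nat).
Local Notation Mat := 'M[scalar_field R Complexes]_n.

Lemma mtends_closure (T : Type) (F : set_system T) {FF : ProperFilter F}
    (H : set Mat) (u : T -> Mat) Z :
  (\forall x \near F, H (u x)) -> mtends F u Z -> closure H Z.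
Proof.
move=> Hu /cvg_mtends uZ B /uZ FB.
by have [x [? ?]] := filter_ex (filterI Hu FB); exists (u x).
Qed.

Lemma lie_group_exp (H : set Mat) X t : lie_algebra H X -> H (expm (rscal t X)).
Proof. by move/(_ t); rewrite mexp_expm. Qed.

Lemma lie_algebraP (H : set Mat) X :
  (forall t, H (expm (rscal t X))) -> lie_algebra H X.
Proof. by move=> HX t; rewrite mexp_expm; exact: HX. Qed.

(** By [power_limit] the exponentials of [Z] are limits of powers of elements of
    [H], and [H] is closed in the general linear group. *)
Lemma tangent_lie_algebra (H : set Mat) (T : Type) (F : set_system T)
    {FF : ProperFilter F} (u : T -> Mat) (tau : T -> R) Z :
  linear_lie_group H -> (\forall x \near F, H (u x)) -> (\forall x \near F, 0 < tau x) ->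
  tau x @[x --> F] --> (0 : R) ->
  mtends F (fun x => rscal (tau x)^-1 (u x - 1%:M)) Z ->
  lie_algebra H Z.
Proof.
move=> [_ H1 HM HV Hc] Hu tau_gt0 tau0 uZ.
have pos t : 0 <= t -> H (expm (rscal t Z)).
  move=> t0; apply: Hc; first exact: expm_unit.
  have [_ h] := power_limit t0 tau_gt0 tau0 uZ.
  apply: (mtends_closure _ h); apply: filterS Hu => x Hx.
  elim: (Num.trunc _) => [|m IH]; first by rewrite expr0.
  have -> : u x ^+ m.+1 = u x *m u x ^+ m by rewrite exprS.
  exact: HM.
apply: lie_algebraP => t; have [t0|t0] := leP 0 t; first exact: pos.
have := HV _ (pos (- t) _); rewrite expm_inv opprK; apply.
by rewrite oppr_ge0 ltW.
Qed.

(** Sums and brackets are tangent to products and commutators of exponentials. *)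
Lemma lie_algebra_subalgebra (H : set Mat) :
  linear_lie_group H -> lie_subalgebra (lie_algebra H).
Proof.
move=> Hg; have [_ H1 HM HV Hc] := Hg.
have scal t X : lie_algebra H X -> lie_algebra H (rscal t X).
  by move=> HX; apply: lie_algebraP => s; rewrite rscalA; exact: lie_group_exp.
split.
- by apply: lie_algebraP => t; rewrite rscalr0 -(rscal0 (0 : Mat)) expm0.
- move=> t X Y /(scal t) HX HY.
  apply: (tangent_lie_algebra Hg _ (@at_right0_gt0 R) (@at_right0_cvg R)
    (expm_mul_tangent _ _)).
  apply: nearW => s; apply: HM; first exact: (lie_group_exp s HX).
  exact: (lie_group_exp s HY).
- move=> X Y HX HY.
  have h := expm_commutator_tangent X Y.
  have h1 : \forall s \near (0 : R)^'+, 0 < s ^+ 2.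
    by apply: filterS (@at_right0_gt0 R) => s s0; rewrite exprn_gt0.
  have h2 : s ^+ 2 @[s --> (0 : R)^'+] --> (0 : R).
    rewrite -[X in _ --> X](mulr0 (0 : R)); under eq_fun do rewrite expr2.
    by apply: cvgM; exact: (@at_right0_cvg R).
  refine (@tangent_lie_algebra H R _ _ _ _ _ Hg _ h1 h2 h).
  apply: nearW => s; apply: (HM); apply: HM.
  - exact: (lie_group_exp s HX).
  - exact: (lie_group_exp s HY).
  - exact: (lie_group_exp (- s) HX).
  - exact: (lie_group_exp (- s) HY).
Qed.

End LieGroups.

(** * Rigidity of connected groups *)

Section Rigidity.
Variables (R : realType).

(** If [u] leaves the identity in the direction [Y], then multiplying [u] by
    [exp (- |u - 1| Y)] cancels its first-order displacement. *)
Lemma cancel_tangent (k : scalar_kind) p (T : Type) (F : set_system T)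
    {FF : Filter F} (u : T -> 'M[scalar_field R k]_p) Y :
  (\forall x \near F, 0 < mnorm (u x - 1%:M)) -> mtends F u 1%:M ->
  mtends F (fun x => rscal (mnorm (u x - 1%:M))^-1 (u x - 1%:M)) Y ->
  mtends F (fun x => rscal (mnorm (u x - 1%:M))^-1
    (expm (rscal (- mnorm (u x - 1%:M)) Y) *m u x - 1%:M)) 0.
Proof.
move=> e_gt0 u1 uY.
have e0 : mnorm (u x - 1%:M) @[x --> F] --> (0 : R) by exact: u1.
pose s x := - mnorm (u x - 1%:M).
have s0 : s x @[x --> F] --> (0 : R) by rewrite -[X in _ --> X]oppr0; exact: cvgN.
have sn0 : \forall x \near F, s x != 0.
  by apply: filterS e_gt0 => x; rewrite oppr_eq0 => /gt_eqF ->.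
have a1 : mtends F (fun x => rscal (s x)^-1 (expm (rscal (s x) Y) - 1%:M)) Y.
  exact: expm_tangent.
have -> : (0 : 'M[scalar_field R k]_p) = - Y *m 1%:M + Y by rewrite mulmx1 addNr.
apply: (mtends_near (u := fun x =>
   (- rscal (s x)^-1 (expm (rscal (s x) Y) - 1%:M)) *m u x +
   rscal (mnorm (u x - 1%:M))^-1 (u x - 1%:M))).
  apply: nearW => x; rewrite /s invrN.
  have N t (A : 'M[scalar_field R k]_p) : - rscal (- t) A = rscal t A.
    by rewrite /rscal of_realN scaleNr opprK.
  rewrite N rscalMl -rscalDr; congr rscal.
  by rewrite mulmxBl mul1mx addrA subrK.
by apply: mtendsD => //; apply: mtendsM => //; exact: mtendsN.
Qed.

Lemma closure_mnorm (k : scalar_kind) p (H : set 'M[scalar_field R k]_p) g :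
  (forall e : R, 0 < e -> exists2 h, H h & mnorm (h - g) < e) -> closure H g.
Proof.
move=> Hg B /nbhs_ballP [e /= /pos_of_real [d d0 ->] sB].
have [h Hh hg] := Hg d d0; exists h; split=> //; apply: sB.
by apply: mnorm_ball; rewrite mnorm_distC.
Qed.

Variable n : nat.
Local Notation Mat := 'M[scalar_field R Complexes]_n.

(** Take for [u] a translate [h *m g] whose distance to the identity is less than
    twice the infimum over [h] in [H]; a near-minimizer avoids any compactness
    of [H].  The infimum is positive, for otherwise [invmx g] would be a limit
    of elements of [H]. *)
Lemma near_best_translate (G H : set Mat) g :
  linear_lie_group G -> linear_lie_group H -> H `<=` G -> G g -> ~ H g ->
  exists u : Mat, [/\ G u, 0 < mnorm (u - 1%:M),
    mnorm (u - 1%:M) <= 2 * mnorm (g - 1%:M) &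
    forall h, H h -> mnorm (u - 1%:M) <= 2 * mnorm (h *m u - 1%:M)].
Proof.
move=> [Gu _ GM _ _] [_ H1 HM HV Hc] HG Gg nHg.
pose S := [set x : R | exists2 h, H h & x = mnorm (h *m g - 1%:M)].
have Sinf : has_inf S.
  split; first by exists (mnorm (1%:M *m g - 1%:M)); exists 1%:M.
  by exists 0 => _ [h _ ->]; exact: mnorm_ge0.
have lb h : H h -> inf S <= mnorm (h *m g - 1%:M).
  by move=> Hh; apply: ge_inf; [case: Sinf|exists h].
have dpos : 0 < inf S.
  rewrite ltNge; apply/negP => d0; apply: nHg.
  have ginv := Gu _ Gg.
  have gVg : g *m invmx g = 1%:M by rewrite mulmxV.
  suff /HV : H (invmx g) by rewrite invmxK.
  apply: Hc; first by rewrite unitmx_inv.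
  apply: closure_mnorm => e e0.
  have c0 : 0 < mnorm (invmx g) + 1 by rewrite ltr_wpDl ?mnorm_ge0.
  have [_ [h Hh ->] hlt] := inf_adherent (divr_gt0 e0 c0) Sinf.
  exists h => //.
  have {}hlt : mnorm (h *m g - 1%:M) < e / (mnorm (invmx g) + 1).
    by apply: lt_le_trans hlt _; rewrite gerDr.
  have -> : h - invmx g = (h *m g - 1%:M) *m invmx g.
    by rewrite mulmxBl mul1mx -mulmxA gVg mulmx1.
  apply: le_lt_trans (mnormM _ _) _.
  apply: (@le_lt_trans _ _ (mnorm (h *m g - 1%:M) * (mnorm (invmx g) + 1))).
    by rewrite ler_wpM2l ?mnorm_ge0// lerDl.
  by rewrite -ltr_pdivlMr.
have [_ [h Hh ->] hlt] := inf_adherent dpos Sinf.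
exists (h *m g); split.
- by apply: GM => //; exact: HG.
- by apply: lt_le_trans dpos _; exact: lb.
- have := lb _ H1; rewrite mul1mx => h1; lra.
- by move=> h' Hh'; have := lb _ (HM _ _ Hh' Hh); rewrite -mulmxA => h1; lra.
Qed.

(** Otherwise take an ultrafilter at the identity containing [G] minus [H], and
    translates [u g] as in [near_best_translate].  The limit direction [Y] is
    tangent to [G], hence to [H], and [cancel_tangent] improves [u g] by more
    than the factor two. *)
Lemma lie_group_nbhs1 (G H : set Mat) :
  linear_lie_group G -> linear_lie_group H -> H `<=` G ->
  lie_algebra G `<=` lie_algebra H ->
  \forall g \near (1%:M : Mat), G g -> H g.
Proof.
move=> Gg Hg HG LGH; apply: contrapT => nn.
pose B := [set g : Mat | G g /\ ~ H g].
have FP : ProperFilter (within B (nbhs (1%:M : Mat))).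
  apply: Build_ProperFilter_ex => P; rewrite /within /= => BP.
  apply: contrapT => nP; apply: nn.
  apply: (@filterS _ (nbhs (1%:M : Mat)) _ _ _ _ BP) => g gP Gg'.
  by apply: contrapT => nH; apply: nP; exists g; exact: gP.
have [U [UU sU]] := ultraFilterLemma FP.
have PU : ProperFilter U by exact: ultra_proper.
have UB : \forall g \near U, B g by exact: (sU _ (@withinT _ _ B (nbhs_filter _))).
have [u uP] : exists u : Mat -> Mat, forall g, B g -> [/\ G (u g),
    0 < mnorm (u g - 1%:M), mnorm (u g - 1%:M) <= 2 * mnorm (g - 1%:M) &
    forall h, H h -> mnorm (u g - 1%:M) <= 2 * mnorm (h *m u g - 1%:M)].
  have /choice : forall g, exists v : Mat, B g -> [/\ G v,
      0 < mnorm (v - 1%:M), mnorm (v - 1%:M) <= 2 * mnorm (g - 1%:M) &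
      forall h, H h -> mnorm (v - 1%:M) <= 2 * mnorm (h *m v - 1%:M)].
    move=> g; have [[Gg' nHg]|nB] := pselect (B g); last by exists 1%:M.
    by have [v vP] := near_best_translate Gg Hg HG Gg' nHg; exists v.
  by case=> u uP; exists u.
pose e g := mnorm (u g - 1%:M).
have e_gt0 : \forall g \near U, 0 < e g by apply: filterS UB => g /uP[].
have g1 : mtends U (id : Mat -> Mat) 1%:M.
  apply: (mtends_sub (F := nbhs (1%:M : Mat))); last exact: mtends_nbhs.
  move=> A hA; apply: sU; rewrite /within /=.
  exact: (@filterS _ (nbhs (1%:M : Mat)) _ _ _ (fun g Ag _ => Ag) hA).
have u1 : mtends U u 1%:M.
  apply: (mtends_bound (h := fun g => 2 * mnorm (g - 1%:M))).
    by apply: filterS UB => g /uP[].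
  by rewrite -[X in _ --> X](mulr0 (2 : R)); exact: cvgMl_tmp.
have [Y uY] : exists Y, mtends U (fun g => rscal (e g)^-1 (u g - 1%:M)) Y.
  apply: (@ultra_mtends _ _ _ _ _ _ _ 1) => //.
  apply: filterS e_gt0 => g eg.
  by rewrite mnorm_rscal gtr0_norm ?invr_gt0// mulVf// gt_eqF.
have HY : lie_algebra H Y.
  apply: LGH; refine (tangent_lie_algebra Gg _ e_gt0 u1 uY).
  by apply: filterS UB => g /uP[].
have h0 : mtends U (fun g => rscal (e g)^-1 (expm (rscal (- e g) Y) *m u g - 1%:M)) 0.
  exact: cancel_tangent e_gt0 u1 uY.
pose r g := mnorm (rscal (e g)^-1 (expm (rscal (- e g) Y) *m u g - 1%:M)).
(* Any bound below [1/2] contradicts the factor two of [best]. *)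
have small : \forall g \near U, r g <= 4^-1.
  have r0 : r g @[g --> U] --> (0 : R).
    by rewrite -(mnorm0 R Complexes n n); exact: (mtends_norm h0).
  have q0 : (0 : R) < 4^-1 by rewrite invr_gt0 ltr0n.
  move/cvgr0Pnorm_le : r0 => /(_ _ q0); apply: filterS => g.
  by rewrite ger0_norm ?mnorm_ge0.
have [g [[eg /uP[_ _ _ best]]]] := filter_ex (filterI (filterI e_gt0 UB) small).
have := best _ (lie_group_exp (- e g) HY); rewrite -/(e g).
rewrite /r mnorm_rscal gtr0_norm ?invr_gt0// ler_pdivrMl// => h1 h2; lra.
Qed.

(** By [lie_group_nbhs1] and translation, [H] is open in [G]; it is also closed in
    [G], which is connected. *)
Theorem lie_group_rigidity (G H : set Mat) :
  linear_lie_group G -> connected G -> linear_lie_group H -> H `<=` G ->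
  lie_algebra G `<=` lie_algebra H -> G `<=` H.
Proof.
move=> Gg Gc Hg HG LGH.
have near1 := lie_group_nbhs1 Gg Hg HG LGH.
have [Gu _ GM GV _] := Gg; have [Hu H1 HM HV Hc] := Hg.
suff -> : H = G by [].
apply: Gc; first by exists 1%:M.
  exists (interior [set x | G x -> H x]); first exact: open_interior.
  apply/seteqP; split=> [h Hh|x [Gx /interior_subset]]; last exact.
  split; first exact: HG.
  have h1 : mtends (nbhs h) (fun x => invmx h *m x) 1%:M.
    rewrite -(mulVmx (Hu _ Hh)); apply: mtendsM; first exact: mtends_cst.
    exact: mtends_nbhs.
  have h2 := iffRL (@cvg_mtends R Complexes Mat (nbhs h) (nbhs_filter h) n n _ _) h1.
  apply: (@filterS _ (nbhs h) _ _ _ _ (h2 _ near1)) => x xP Gx.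
  rewrite -[x](mulKVmx (Hu _ Hh)); apply: HM => //.
  by apply: xP; apply: GM => //; apply: GV; exact: HG.
exists (closure H); first exact: closed_closure.
apply/seteqP; split=> [h Hh|x [Gx cHx]]; first by split; [exact: HG|exact: subset_closure].
by apply: Hc => //; exact: Gu.
Qed.

End Rigidity.

(** * Representations and intertwiners *)

Section IndexedMatrices.
Variable K : pzSemiRingType.

Definition mx_of (I J : finType) (A : I -> J -> K) : 'M[K]_(#|I|, #|J|) :=
  \matrix_(i, j) A (enum_val i) (enum_val j).

Lemma mx_ofE (I J : finType) (A : I -> J -> K) i j :
  mx_of A (enum_rank i) (enum_rank j) = A i j.
Proof. by rewrite mxE !enum_rankK. Qed.

Lemma mx_of_mul (I J L : finType) (A : I -> J -> K) (B : J -> L -> K) :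
  mx_of A *m mx_of B = mx_of (fun i j => \sum_r A i r * B r j).
Proof.
apply/matrixP => i j; rewrite !mxE (reindex (@enum_val _ J)) /=.
  by apply: eq_bigr => r _; rewrite !mxE.
exact/onW_bij/enum_val_bij.
Qed.

Lemma mx_of1 (I : finType) : mx_of (fun i j : I => (i == j)%:R) = 1%:M.
Proof. by apply/matrixP => i j; rewrite !mxE (inj_eq enum_val_inj). Qed.

Lemma eq_mx_of (I J : finType) (A B : I -> J -> K) :
  mx_of A = mx_of B <-> A =2 B.
Proof.
split=> [/matrixP AB i j|AB]; first by rewrite -mx_ofE AB mx_ofE.
by apply/matrixP => i j; rewrite !mxE AB.
Qed.

End IndexedMatrices.

Section ExponentialIntertwiners.
Variables (R : realType) (k : scalar_kind).
Local Notation K := (scalar_field R k).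

(** Differentiate at [0] in one direction; in the other, intertwine the series
    term by term. *)
Lemma expm_intertwine p q (T : 'M[K]_(q, p)) A B :
  (forall t, T *m expm (rscal t A) = expm (rscal t B) *m T) <->
  T *m A = B *m T.
Proof.
split=> [TAB|TAB t].
  apply: (@mtends_unique R k _ ((0 : R)^'+) _ _ _
    (fun t => T *m rscal t^-1 (expm (rscal t A) - 1%:M))).
    by apply: mtendsM; [exact: mtends_cst|exact: expm_tangent0].
  apply: (mtends_near (u := fun t => rscal t^-1 (expm (rscal t B) - 1%:M) *m T)).
    apply: nearW => t; rewrite rscalMl rscalMr; congr rscal.
    by rewrite mulmxBl mulmxBr mul1mx mulmx1 TAB.
  by apply: mtendsM; [exact: expm_tangent0|exact: mtends_cst].
have TX j : T *m A ^+ j = B ^+ j *m T.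
  elim: j => [|j IH]; first by rewrite !expr0 mul1mx mulmx1.
  have -> : A ^+ j.+1 = A *m A ^+ j by rewrite exprS.
  have -> : B ^+ j.+1 = B *m B ^+ j by rewrite exprS.
  by rewrite mulmxA TAB -!mulmxA IH.
apply: (@mtends_unique R k _ \oo _ _ _ (fun j => T *m expsum (rscal t A) j)).
  by apply: mtendsM; [exact: mtends_cst|exact: expsum_tends].
apply: (mtends_near (u := fun j => expsum (rscal t B) j *m T)).
  apply: nearW => j; rewrite !expsum_rscal mulmx_sumr mulmx_suml.
  by apply: eq_bigr => i _; rewrite rscalMl rscalMr TX.
by apply: mtendsM; [exact: expsum_tends|exact: mtends_cst].
Qed.

End ExponentialIntertwiners.

Section Representations.
Variables (R : realType) (k : scalar_kind) (n : nat).
Local Notation K := (scalar_field R k).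
Local Notation Mat := 'M[scalar_field R Complexes]_n.
Variable G : set Mat.

Definition matrix_rep (I : finType) (rho : Mat -> I -> I -> K) : Prop :=
  [/\ mx_of (rho 1%:M) = 1%:M,
      forall g h, G g -> G h -> mx_of (rho (g *m h)) = mx_of (rho g) *m mx_of (rho h) &
      continuous_rep G rho].

Lemma matrix_rep_cvg (I : finType) (rho : Mat -> I -> I -> K) g (T : Type)
    (F : set_system T) (FF : Filter F) (u : T -> Mat) :
  continuous_rep G rho -> G g -> (forall x, G (u x)) -> mtends F u g ->
  mtends F (fun x => mx_of (rho (u x))) (mx_of (rho g)).
Proof.
move=> rc Gg Gu ug; apply/mtendsP => i j; under eq_fun do rewrite !mxE.
apply/cvg_modulus.
have /subspace_continuousP /(_ _ Gg) rg := rc (enum_val i) (enum_val j).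
move=> A nA.
have hA : nbhs g (fun x => G x -> A (rho x (enum_val i) (enum_val j))) := rg A nA.
have ug' := iffRL (@cvg_mtends R Complexes T F FF n n _ _) ug.
by apply: (@filterS _ F _ _ _ _ (ug' _ hA)) => x; apply; exact: Gu.
Qed.

Lemma matrix_rep_cvg_within (I : finType) (rho : Mat -> I -> I -> K) g (H : set Mat) :
  continuous_rep G rho -> G g -> H `<=` G ->
  mtends (within H (nbhs g)) (fun x => mx_of (rho x)) (mx_of (rho g)).
Proof.
move=> rc Gg HG; apply/mtendsP => i j; under eq_fun do rewrite !mxE.
apply/cvg_modulus.
have /subspace_continuousP /(_ _ Gg) rg := rc (enum_val i) (enum_val j).
move=> A nA.
have hA : nbhs g (fun x => G x -> A (rho x (enum_val i) (enum_val j))) := rg A nA.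
exact: (@filterS _ (nbhs g) _ _ _ (fun x xP Hx => xP (HG _ Hx)) hA).
Qed.

(** The limit defining [drep] exists as soon as the representation is
    exponential along [X]; without that, [lim] would be an arbitrary value. *)
Lemma drep_cvg (I : finType) (rho : Mat -> I -> I -> K) X A :
  (forall t, mx_of (rho (expm (rscal t X))) = expm (rscal t A)) ->
  mx_of (drep rho X) = A /\
  (forall i j, (of_real k t)^-1 * (rho (expm (rscal t X)) i j - rho 1%:M i j)
     @[t --> (0 : R)^'] --> drep rho X i j).
Proof.
move=> rX.
have h : mtends ((0 : R)^') (fun t => rscal t^-1 (expm (rscal t A) - 1%:M)) A.
  apply: expm_tangent; first exact: nbhs_dnbhs.
  exact: nbhs_dnbhs_neq.
have h1 i j : (of_real k t)^-1 * (rho (expm (rscal t X)) i j - rho 1%:M i j)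
     @[t --> (0 : R)^'] --> A (enum_rank i) (enum_rank j).
  have -> : (fun t => (of_real k t)^-1 * (rho (expm (rscal t X)) i j - rho 1%:M i j)) =
      (fun t => rscal t^-1 (expm (rscal t A) - 1%:M) (enum_rank i) (enum_rank j)).
    apply/funext => t; rewrite -(expm0 A) -!rX rscal0 -(rscal0 X) expm0.
    by rewrite !mxE of_realV !enum_rankK.
  by apply/cvg_modulus; move/mtendsP : h; apply.
have h2 i j : drep rho X i j = A (enum_rank i) (enum_rank j).
  rewrite /drep -(norm_cvg_lim (h1 i j)).
  have -> // : (fun t => (of_real k t)^-1 *
      (rho (mexp (rscale t X)) i j - rho (mexp (rscale 0 X)) i j)) =
      (fun t => (of_real k t)^-1 * (rho (expm (rscal t X)) i j - rho 1%:M i j)).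
  apply/funext => t; rewrite !mexp_expm.
  by rewrite -[rscale t X]/(rscal t X) -[rscale 0 X]/(rscal 0 X) expm0.
split=> [|i j]; last by rewrite h2; exact: h1.
by apply/matrixP => i j; rewrite mxE h2 !enum_valK.
Qed.

Lemma matrix_rep_exp (I : finType) (rho : Mat -> I -> I -> K) X :
  matrix_rep rho -> lie_algebra G X ->
  forall t, mx_of (rho (expm (rscal t X))) = expm (rscal t (mx_of (drep rho X))).
Proof.
move=> [r1 rM rc] GX.
have [A rA] : exists A, forall t, mx_of (rho (expm (rscal t X))) = expm (rscal t A).
  apply: one_parameter_group.
  - by rewrite expm0.
  - move=> s t; rewrite -expmD rM//; [exact: (lie_group_exp s GX)|exact: (lie_group_exp t GX)].
  - move=> t; apply: matrix_rep_cvg rc (lie_group_exp t GX) _ _.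
      by move=> s; exact: (lie_group_exp s GX).
    by apply: expm_cvg; exact: cvg_id.
by have [-> _] := drep_cvg rA.
Qed.

Lemma mem_generators Ndim (X : 'I_Ndim -> Mat) d :
  lie_generates X (lie_algebra G) -> lie_algebra G (X d).
Proof. by move=> ->; move=> h [_]; apply; exists d. Qed.

(** Closedness comes from the continuity of both representations on [G]. *)
Lemma intertwiner_lie_group (I J : finType) (P : Mat -> I -> I -> K)
    (Q : Mat -> J -> J -> K) (T : 'M[K]_(#|J|, #|I|)) :
  linear_lie_group G -> matrix_rep P -> matrix_rep Q ->
  linear_lie_group [set g | G g /\ T *m mx_of (P g) = mx_of (Q g) *m T].
Proof.
move=> [Gu G1 GM GV Gc] [P1 PM Pc] [Q1 QM Qc]; split.
- by move=> g [/Gu].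
- by split=> //; rewrite P1 Q1 mulmx1 mul1mx.
- move=> g h [Gg Tg] [Gh Th]; split; first exact: GM.
  by rewrite PM// QM// mulmxA Tg -mulmxA Th mulmxA.
- move=> g [Gg Tg]; have Gi := GV _ Gg; split=> //.
  have PV : mx_of (P g) *m mx_of (P (invmx g)) = 1%:M.
    by rewrite -PM// mulmxV ?P1// Gu.
  have QV : mx_of (Q (invmx g)) *m mx_of (Q g) = 1%:M.
    by rewrite -QM// mulVmx ?Q1// Gu.
  by rewrite -[T in LHS]mul1mx -QV -(mulmxA _ _ T) -Tg -!mulmxA PV mulmx1.
- set H := [set _ | _] => g gu Hg.
  have HG : H `<=` G by move=> x [].
  have Gg : G g by apply: Gc => //; exact: closure_subset Hg.
  split=> //.
  have FP : ProperFilter (within H (nbhs g)) by exact: within_nbhs_proper.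
  apply: (@mtends_unique R k _ (within H (nbhs g)) _ _ _ (fun x => T *m mx_of (P x))).
    by apply: mtendsM; [exact: mtends_cst|exact: matrix_rep_cvg_within].
  apply: (mtends_near (u := fun x => mx_of (Q x) *m T)).
    by rewrite near_withinE; apply: nearW => x [_ ->].
  by apply: mtendsM; [exact: matrix_rep_cvg_within|exact: mtends_cst].
Qed.

(** For the converse, the group of [intertwiner_lie_group] has a Lie algebra
    that contains the generators, hence the whole Lie algebra of [G]; conclude
    by [lie_group_rigidity]. *)
Theorem intertwiner_generators (hG : linear_lie_group G) (hGconn : connected G)
    Ndim (X : 'I_Ndim -> Mat) (hX : lie_generates X (lie_algebra G)) (I J : finType)
    (P : Mat -> I -> I -> K) (Q : Mat -> J -> J -> K) (T : 'M[K]_(#|J|, #|I|)) :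
  matrix_rep P -> matrix_rep Q ->
  (forall g, G g -> T *m mx_of (P g) = mx_of (Q g) *m T) <->
  (forall d, T *m mx_of (drep P (X d)) = mx_of (drep Q (X d)) *m T).
Proof.
move=> hP hQ; split=> [TG d|TX g Gg].
  apply/expm_intertwine => t.
  have Xd := mem_generators d hX.
  rewrite -(matrix_rep_exp hP Xd) -(matrix_rep_exp hQ Xd); apply: TG.
  exact: (lie_group_exp t Xd).
pose H := [set g | G g /\ T *m mx_of (P g) = mx_of (Q g) *m T].
have Hg : linear_lie_group H by exact: intertwiner_lie_group.
have HG : H `<=` G by move=> x [].
have LGH : lie_algebra G `<=` lie_algebra H.
  rewrite hX => Y; apply; split; first exact: lie_algebra_subalgebra.
  move=> _ [d _ <-]; apply: lie_algebraP => t; have Xd := mem_generators d hX.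
  split; first exact: (lie_group_exp t Xd).
  rewrite (matrix_rep_exp hP Xd) (matrix_rep_exp hQ Xd).
  exact: (iffRL (expm_intertwine _ _ _)).
by have [] := lie_group_rigidity hG hGconn Hg HG LGH Gg.
Qed.

End Representations.

(** * Spans and orthonormal families *)

(** Distributivity for index types that depend on the factor, reduced to the
    non-dependent case by tagging each index with its factor. *)
Lemma prod_sum_dffun (A : pzSemiRingType) (I : finType) (T_ : I -> finType)
    (f : forall i, T_ i -> A) :
  \prod_i \sum_(j : T_ i) f i j =
  \sum_(m : {dffun forall i, T_ i}) \prod_i f i (m i).
Proof.
pose P i : {ffun T_ i -> A} := [ffun j => f i j].
transitivity (\prod_i \sum_(j in tagged_with (fun x => T_ x) i) untag 0 (P i) j).
  apply: eq_bigr => i _; transitivity (\sum_(j : T_ i) P i j).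
    by apply: eq_bigr => j _; rewrite ffunE.
  exact: (big_tag (fun i => P i : T_ i -> A) i).
rewrite bigA_distr_big_dep -big_fprod.
rewrite (reindex (@fprod_of_dffun I T_)) /=; last first.
  exact/onW_bij/(Bijective (@fprod_of_dffunK I T_) (@dffun_of_fprodK I T_)).
apply: eq_bigr => m _; apply: eq_bigr => i _.
rewrite ffunE; congr (f i _).
by have /(congr1 (fun h : {dffun forall i, T_ i} => h i)) := fprod_of_dffunK m; rewrite ffunE.
Qed.

Section Spans.
Variables (R : realType) (k : scalar_kind) (V : lmodType (scalar_field R k)).
Local Notation K := (scalar_field R k).

Lemma lspan_sum (S : set V) (I : finType) (a : I -> K) (f : I -> V) :
  (forall i, S (f i)) -> lspan S (\sum_i a i *: f i).
Proof.
move=> Sf; exists #|I|, (a \o enum_val), (f \o enum_val); split=> [i|]; first exact: Sf.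
rewrite (reindex (@enum_val _ I)) //=; exact/onW_bij/enum_val_bij.
Qed.

Lemma lspan_linear (S : set V) a f g :
  lspan S f -> lspan S g -> lspan S (a *: f + g).
Proof.
move=> [n1 [a1 [f1 [S1 ->]]]] [n2 [a2 [f2 [S2 ->]]]].
have -> : a *: (\sum_i a1 i *: f1 i) + \sum_i a2 i *: f2 i =
    \sum_(i : 'I_n1 + 'I_n2)
      (match i with inl i => a * a1 i | inr i => a2 i end) *:
      (match i with inl i => f1 i | inr i => f2 i end).
  rewrite big_sumType /= scaler_sumr; congr (_ + _).
  by apply: eq_bigr => i _; rewrite scalerA.
by apply: lspan_sum => -[].
Qed.

Lemma lspan0 (S : set V) : lspan S 0.
Proof. by exists 0%N, (fun=> 0), (fun=> 0); split=> [[]|]//; rewrite big_ord0. Qed.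

Lemma sub_lspan (S : set V) f : S f -> lspan S f.
Proof.
move=> Sf; exists 1%N, (fun=> 1), (fun=> f); split=> //.
by rewrite big_ord1 scale1r.
Qed.

Lemma lspan_coefs (S : set V) (I : finType) (f : I -> V) v :
  (forall w, S w -> exists c : I -> K, w = \sum_i c i *: f i) ->
  lspan S v -> exists c : I -> K, v = \sum_i c i *: f i.
Proof.
move=> Sf [p [a [w [Sw ->]]]].
have [c cP] := choice (fun j => Sf _ (Sw j)).
exists (fun i => \sum_j a j * c j i).
under eq_bigr => j _ do rewrite cP scaler_sumr.
rewrite exchange_big; apply: eq_bigr => i _; rewrite scaler_suml.
by apply: eq_bigr => j _; rewrite scalerA.
Qed.

Lemma scalar_product_free (S : set V) (ip : V -> V -> K) (I : finType) (f : I -> V) :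
  is_scalar_product (lspan S) ip -> (forall i, lspan S (f i)) ->
  (forall i j, ip (f i) (f j) = (i == j)%:R) ->
  forall a : I -> K, \sum_i a i *: f i = 0 -> forall i, a i = 0.
Proof.
move=> [iplin _ _] Sf fON a a0 j.
have ip0 : ip 0 (f j) = 0.
  have := iplin (-1) 0 0 (f j) (lspan0 _) (lspan0 _) (Sf j).
  by rewrite scaler0 addr0 mulN1r addNr.
have ipsum (r : seq I) : lspan S (\sum_(i <- r) a i *: f i) /\
    ip (\sum_(i <- r) a i *: f i) (f j) = \sum_(i <- r) a i * ip (f i) (f j).
  elim: r => [|i r [IH1 IH2]]; first by rewrite !big_nil; split=> //; exact: lspan0.
  by rewrite !big_cons iplin// IH2; split=> //; exact: lspan_linear.
have [_] := ipsum (index_enum I); rewrite a0 ip0 (bigD1 j)//= fON eqxx mulr1.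
by rewrite big1 ?addr0// => i /negPf ij; rewrite fON ij mulr0.
Qed.

End Spans.

(** * Tensor products of representations *)

(** Leibniz rule for difference quotients.  Writing it as a limit, instead of
    with a derivative, allows [tau] to be a real parameter viewed in complex
    scalars. *)
Lemma cvg_quotient_prod (K : numFieldType) (T : Type) (F : set_system T)
    {FF : Filter F} (tau : T -> K) (I : finType) (f : I -> T -> K) (a b : I -> K) :
  tau x @[x --> F] --> (0 : K) -> (\forall x \near F, tau x != 0) ->
  (forall i, (tau x)^-1 * (f i x - a i) @[x --> F] --> b i) ->
  (tau x)^-1 * (\prod_i f i x - \prod_i a i) @[x --> F] -->
    \sum_i b i * \prod_(j | j != i) a j.
Proof.
move=> tau0 taun0 fb.
suff: forall r : seq I, uniq r ->
    (tau x)^-1 * (\prod_(i <- r) f i x - \prod_(i <- r) a i) @[x --> F] -->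
    \sum_(i <- r) b i * \prod_(j <- r | j != i) a j.
  by apply; exact: index_enum_uniq.
elim=> [_|i r IH /= /andP[ir ur]].
  rewrite [X in _ --> X]big_nil; under eq_fun do rewrite !big_nil subrr mulr0.
  exact: cvg_cst.
have q := IH ur.
have fr : \prod_(j <- r) f j x @[x --> F] --> \prod_(j <- r) a j.
  have : \prod_(j <- r) a j +
      tau x * ((tau x)^-1 * (\prod_(j <- r) f j x - \prod_(j <- r) a j)) @[x --> F] -->
      \prod_(j <- r) a j + 0 * \sum_(j <- r) b j * \prod_(l <- r | l != j) a l.
    by apply: cvgD; [exact: cvg_cst|exact: cvgM].
  rewrite mul0r addr0 => h; apply: cvg_trans h; apply: near_eq_cvg.
  by apply: filterS taun0 => x tx; rewrite mulVKf// addrC subrK.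
have -> : \sum_(j <- i :: r) b j * \prod_(l <- i :: r | l != j) a l =
    b i * \prod_(j <- r) a j + a i * \sum_(j <- r) b j * \prod_(l <- r | l != j) a l.
  rewrite big_cons big_cons eqxx /=; congr (_ * _ + _).
    rewrite big_seq_cond [RHS]big_seq; apply: eq_bigl => j.
    by case: eqVneq => [->|]; rewrite ?andbT// (negPf ir).
  rewrite mulr_sumr !big_seq; apply: eq_bigr => j jr.
  rewrite big_cons; case: eqVneq => [ij|_]; first by rewrite ij jr in ir.
  by rewrite mulrCA.
have -> : (fun x => (tau x)^-1 * (\prod_(j <- i :: r) f j x - \prod_(j <- i :: r) a j)) =
    (fun x => (tau x)^-1 * (f i x - a i) * \prod_(j <- r) f j x +
      a i * ((tau x)^-1 * (\prod_(j <- r) f j x - \prod_(j <- r) a j))).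
  apply/funext => x; rewrite !big_cons.
  by move: (\prod_(j <- r) f j x) (\prod_(j <- r) a j) => u v; ring.
by apply: cvgD; [exact: cvgM|exact: cvgMl_tmp].
Qed.

Section FunctionRepresentations.
Variables (R : realType) (k : scalar_kind) (n : nat).
Local Notation K := (scalar_field R k).
Local Notation Mat := 'M[scalar_field R Complexes]_n.
Variable F : comAlgType K.

(** The matrix entries are determined by the action because the functions are
    linearly independent, so they inherit its multiplicativity. *)
Lemma matrix_rep_functions (G : set Mat) (Y : Type) (act : Mat -> Y -> Y)
    (I : finType) (phi : I -> Y -> F) (rho : Mat -> I -> I -> K) :
  linear_lie_group G -> is_action G act ->
  (forall a : I -> K, \sum_i a i *: phi i = 0 -> forall i, a i = 0) ->
  (forall g, G g -> forall i y, phi i (act g y) = \sum_j rho g i j *: phi j y) ->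
  continuous_rep G rho -> matrix_rep G rho.
Proof.
move=> [_ G1 GM _ _] [act1 actM] free hrho rc.
have uniq (a b : I -> K) : (forall y, \sum_i a i *: phi i y = \sum_i b i *: phi i y) ->
    forall i, a i = b i.
  move=> ab i; apply/eqP; rewrite -subr_eq0; apply/eqP.
  apply: (free (fun i => a i - b i)); rewrite fct_sumE; apply/funext => y.
  under eq_bigr do rewrite fctE scalerBl.
  by rewrite sumrB ab subrr.
split=> //.
  rewrite -mx_of1; apply/eq_mx_of => i.
  apply: uniq => y; rewrite -hrho// act1 (bigD1 i)//= eqxx scale1r big1 ?addr0// => j.
  by rewrite eq_sym => /negPf ->; rewrite scale0r.
move=> g h Gg Gh; rewrite mx_of_mul; apply/eq_mx_of => i; apply: uniq => y.
rewrite -hrho; last exact: GM.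
rewrite actM// hrho//; under eq_bigr => j _ do rewrite hrho// scaler_sumr.
rewrite exchange_big; apply: eq_bigr => j _; rewrite scaler_suml.
by apply: eq_bigr => r _; rewrite scalerA.
Qed.

End FunctionRepresentations.

Section TensorRepresentation.
Variables (R : realType) (k : scalar_kind) (n : nat).
Local Notation K := (scalar_field R k).
Local Notation Mat := 'M[scalar_field R Complexes]_n.
Variables (L : Type) (dM : Order.disp_t) (M : L -> finOrderType dM).
Variables (N : nat) (l : 'I_N -> L).
Variable rho : forall l : L, Mat -> M l -> M l -> K.

Definition tensor_rep (g : Mat) (m m' : multi_index M l) : K :=
  \prod_i rho g (m i) (m' i).

Lemma cvg_prod (T I : Type) (F : set_system T) {FF : Filter F} (r : seq I)
    (f : I -> T -> K) (a : I -> K) :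
  (forall i, f i x @[x --> F] --> a i) ->
  \prod_(i <- r) f i x @[x --> F] --> \prod_(i <- r) a i.
Proof.
move=> fa; elim: r => [|i r IH].
  by rewrite [X in _ --> X]big_nil; under eq_fun do rewrite big_nil; exact: cvg_cst.
rewrite [X in _ --> X]big_cons; under eq_fun do rewrite big_cons.
exact: (cvgM (fa i) IH).
Qed.

Lemma tensor_rep_continuous (G : set Mat) :
  (forall l, continuous_rep G (@rho l)) -> continuous_rep G tensor_rep.
Proof.
move=> rc m m'; apply/subspace_continuousP => g Gg; apply: cvg_prod => i.
by have /subspace_continuousP := rc (l i) (m i) (m' i); apply.
Qed.

(** Leibniz rule; at the identity the factors that are not differentiated are
    Kronecker deltas. *)
Lemma drep_tensor (G : set Mat) X m m' :
  lie_algebra G X ->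
  (forall l, matrix_rep G (@rho l)) -> matrix_rep G tensor_rep ->
  drep tensor_rep X m m' =
  \sum_j drep (@rho (l j)) X (m j) (m' j) * \prod_(s | s != j) (m s == m' s)%:R.
Proof.
move=> GX hr hP.
have [_ /(_ m m') h] := drep_cvg (matrix_rep_exp hP GX).
apply: (norm_cvg_unique h).
have r1 i (a b : M (l i)) : rho 1%:M a b = (a == b)%:R.
  by have [+ _ _] := hr (l i); rewrite -mx_of1 => /eq_mx_of ->.
under eq_bigr => j _.
  under eq_bigr => s _ do rewrite -r1; over.
apply: cvg_quotient_prod.
- apply/cvg_modulus.
  have -> : (fun t : R => modulus (of_real k t - 0)) = (fun t => `|t|).
    by apply/funext => t; rewrite subr0 modulus_of_real.
  have : `|t| @[t --> (0 : R)^'] --> `|0 : R| by apply: cvg_norm; exact: nbhs_dnbhs.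
  by rewrite normr0.
- apply: filterS (nbhs_dnbhs_neq (0 : R)) => t t0.
  apply: contra_neq t0 => /(congr1 (@modulus R k)).
  by rewrite modulus_of_real modulus0 => /normr0_eq0.
- by move=> i; have [_ /(_ (m i) (m' i))] := drep_cvg (matrix_rep_exp (hr (l i)) GX).
Qed.

Variables (F : comAlgType K) (Omega : Type) (phi : forall l : L, M l -> Omega -> F).

Lemma phi_multi_act (G : set Mat) (act : Mat -> Omega -> Omega) g m (r : 'I_N -> Omega) :
  (forall (l : L) g, G g -> forall (m : M l) (r : Omega),
     phi m (act g r) = \sum_(m' : M l) rho g m m' *: phi m' r) ->
  G g ->
  phi_multi (l := l) phi m (fun i => act g (r i)) =
  \sum_m' tensor_rep g m m' *: phi_multi phi m' r.
Proof.
move=> hrho Gg; rewrite /phi_multi /tensor.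
under eq_bigr do rewrite hrho//.
rewrite (prod_sum_dffun (fun i (m' : M (l i)) => rho g (m i) m' *: phi m' (r i))).
by apply: eq_bigr => m' _; rewrite scaler_prod.
Qed.

Lemma phi_multi_Vtensor (m : multi_index M l) : Vtensor phi l (phi_multi phi m).
Proof.
apply: sub_lspan; exists (fun i => phi (m i)) => // i.
by apply: sub_lspan; exists (m i).
Qed.

Lemma Vtensor_coefs f : Vtensor phi l f ->
  exists c : multi_index M l -> K, f = \sum_m c m *: phi_multi phi m.
Proof.
apply: lspan_coefs => _ [h Vh <-].
have H i : exists c : M (l i) -> K, h i = \sum_m c m *: phi m.
  have := Vh i; apply: lspan_coefs => _ [m _ <-].
  exists (fun m' => (m' == m)%:R); rewrite (bigD1 m)//= eqxx scale1r big1 ?addr0//.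
  by move=> m' /negPf ->; rewrite scale0r.
pose c i := sval (cid (H i)).
exists (fun m : multi_index M l => \prod_i c i (m i)); apply/funext => r; rewrite fct_sumE /tensor.
have -> : \prod_i h i (r i) = \prod_i \sum_m c i m *: phi m (r i).
  by apply: eq_bigr => i _; rewrite {1}(svalP (cid (H i))) fct_sumE.
rewrite (prod_sum_dffun (fun i (m : M (l i)) => c i m *: phi m (r i))).
by apply: eq_bigr => m _; rewrite scaler_prod.
Qed.

(** The products need not be independent for a general algebra [F]; it is the
    tensor scalar product that forces them to be orthonormal. *)
Lemma phi_multi_free ip ipN :
  orthonormal_family phi ip -> is_tensor_scalar_product phi l ip ipN ->
  forall a : multi_index M l -> K,
    \sum_m a m *: phi_multi phi m = 0 -> forall m, a m = 0.
Proof.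
move=> [ON _] [ipNs ipNt]; apply: (scalar_product_free ipNs phi_multi_Vtensor) => m m'.
have V (m0 : multi_index M l) i : Vspace phi (l i) (phi (m0 i)).
  by apply: sub_lspan; exists (m0 i).
rewrite /phi_multi ipNt//; under eq_bigr do rewrite ON.
have [->|mm'] := eqVneq m m'; first by rewrite big1// => i _; rewrite eqxx.
have [i mi] : exists i, m i != m' i.
  apply/existsP; rewrite -negb_forall; apply: contra mm' => /forallP mm'.
  by apply/eqP/ffunP => i; apply/eqP.
by rewrite (bigD1 i)//= (negPf mi) mul0r.
Qed.

Lemma phi_free ip (l0 : L) :
  is_scalar_product (Vtotal phi) ip -> orthonormal_family phi ip ->
  forall a : M l0 -> K, \sum_m a m *: phi m = 0 -> forall m, a m = 0.
Proof.
move=> ips [ON _]; apply: (scalar_product_free ips) => [m|m m']; last exact: ON.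
by apply: sub_lspan; exists l0, m.
Qed.

End TensorRepresentation.

(** * The matrix of the infinitesimal equations *)

Section Kernel.
Variables (R : realType) (k : scalar_kind).
Local Notation K := (scalar_field R k).
Variables (L : Type) (dM : Order.disp_t) (M : L -> finOrderType dM).
Variables (N Ndim : nat).
Variable varrho : forall l, 'I_Ndim -> M l -> M l -> K.
Variables (l : 'I_N -> L) (l0 : L).

(** The derivative of the tensor representation, see [drep_tensor]. *)
Definition leibniz (d : 'I_Ndim) (m m' : multi_index M l) : K :=
  \sum_j varrho d (m j) (m' j) * \prod_(s | s != j) (m s == m' s)%:R.

Lemma leibniz_diag d m : leibniz d m m = \sum_j varrho d (m j) (m j).
Proof.
apply: eq_bigr => j _; rewrite big1 ?mulr1// => s _; by rewrite eqxx.
Qed.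

Lemma leibniz_offdiag d m m' : m != m' ->
  leibniz d m' m =
  if [pick j | (m j != m' j) && [forall (s | s != j), m s == m' s]] is Some j
  then varrho d (m' j) (m j) else 0.
Proof.
move=> mm'; case: pickP => [j /andP[mj /forall_inP ms]|none].
  rewrite /leibniz (bigD1 j)//= big1 ?mulr1 => [|s sj]; last by rewrite eq_sym ms.
  rewrite big1 ?addr0// => i ij.
  have ji : j != i by rewrite eq_sym.
  by rewrite (bigD1 j ji) /= eq_sym (negPf mj) mul0r mulr0.
rewrite /leibniz big1// => j _.
have [s sj ms] : exists2 s, s != j & m' s != m s.
  apply/exists_inP; rewrite -[X in is_true X]negbK negb_exists_in; apply/negP => /forall_inP h.
  have {}h s : s != j -> m s == m' s by move/h; rewrite negbK eq_sym.
  have := none j; have -> : [forall (s | s != j), m s == m' s] by apply/forall_inP.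
  rewrite andbT => /negbFE mj; case/negP: mm'; apply/eqP/ffunP => s.
  by have [->|/h] := eqVneq s j; apply/eqP.
by rewrite (bigD1 s)//= (negPf ms) mul0r mulr0.
Qed.

(** The case distinction in [M_entry] is the difference of two Kronecker
    products, the first with the transpose of the Leibniz matrix. *)
Lemma M_entryE d m a m' a' :
  M_entry varrho d ((m, a) : index_set M l l0) ((m', a') : index_set M l l0) =
  (a == a')%:R * leibniz d m' m - (m == m')%:R * varrho d a a'.
Proof.
rewrite /M_entry; have [<-|mm'] /= := eqVneq m m'.
  have [<-|aa'] /= := eqVneq a a'; first by rewrite !mul1r leibniz_diag.
  by rewrite mul0r mul1r sub0r.
have [_|aa'] /= := eqVneq a a'; last by rewrite !mul0r subr0.
by rewrite mul1r mul0r subr0 leibniz_offdiag.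
Qed.

(** Read with [v] as a matrix indexed by [M l0] and multi-indices, the kernel
    equations say that [v] intertwines the two derivatives. *)
Lemma ker_MP (v : 'cV[K]_#|index_set M l l0|) :
  reflect (forall d m a,
     \sum_m' leibniz d m' m * v (enum_rank ((m', a) : index_set M l l0)) 0 =
     \sum_a' varrho d a a' * v (enum_rank ((m, a') : index_set M l l0)) 0)
    (v \in ker_M varrho l l0).
Proof.
have E d m a : (M_block varrho l l0 d *m v) (enum_rank ((m, a) : index_set M l l0)) 0 =
    \sum_m' leibniz d m' m * v (enum_rank ((m', a) : index_set M l l0)) 0 -
    \sum_a' varrho d a a' * v (enum_rank ((m, a') : index_set M l l0)) 0.
  rewrite mxE (reindex (@enum_rank (index_set M l l0))) /=; last first.
    exact/onW_bij/enum_rank_bij.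
  pose f m' a' := M_entry varrho d ((m, a) : index_set M l l0) ((m', a') : index_set M l l0) *
    v (enum_rank ((m', a') : index_set M l l0)) 0.
  transitivity (\sum_m' \sum_a' f m' a').
    by rewrite pair_big /=; apply: eq_bigr => -[m' a'] _; rewrite mxE !enum_rankK.
  have row m' : \sum_a' f m' a' =
      leibniz d m' m * v (enum_rank ((m', a) : index_set M l l0)) 0 -
      (m == m')%:R *
        \sum_a' varrho d a a' * v (enum_rank ((m', a') : index_set M l l0)) 0.
    transitivity (\sum_a'
        ((a == a')%:R * (leibniz d m' m * v (enum_rank ((m', a') : index_set M l l0)) 0) -
         (m == m')%:R * (varrho d a a' * v (enum_rank ((m', a') : index_set M l l0)) 0))).
      by apply: eq_bigr => a' _; rewrite /f M_entryE mulrBl !mulrA.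
    rewrite sumrB -mulr_sumr (bigD1 a)//= eqxx mul1r big1 ?addr0// => a' /negPf aa'.
    by rewrite eq_sym aa' mul0r.
  rewrite (eq_bigr _ (fun m' _ => row m')) sumrB; congr (_ - _).
  rewrite (bigD1 m)//= eqxx mul1r [X in _ + X]big1 ?addr0// => m' /negPf mm'.
  by rewrite eq_sym mm' mul0r.
rewrite memv_ker (lfunE (mulmx (M_stack varrho l l0))) /= /M_stack mxcol_mul.
apply: (iffP eqP) => [v0 d m a|v0].
  have v0d : M_block varrho l l0 d *m v = 0.
    by move: v0; rewrite -(mxcol0 (p_ := fun=> #|index_set M l l0|)) => /eq_mxcolP ->.
  by apply/eqP; rewrite -subr_eq0 -E v0d mxE.
rewrite -(mxcol0 (p_ := fun=> #|index_set M l l0|)); apply/eq_mxcolP => d.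
apply/matrixP => p q; rewrite ord1 [RHS]mxE -(enum_valK p).
by case: (enum_val p) => m a; rewrite E v0 subrr.
Qed.

End Kernel.

(** * Equivariant functions and the kernel *)

Section CoefficientFunctions.
Variables (R : realType) (k : scalar_kind).
Local Notation K := (scalar_field R k).
Variables (F : comAlgType K) (Omega : Type).
Variables (L : Type) (dM : Order.disp_t) (M : L -> finOrderType dM).
Variable phi : forall l, M l -> Omega -> F.
Variables (N : nat) (l : 'I_N -> L) (l0 : L).
Local Notation idx := (index_set M l l0).
Local Notation "'idx_pair' m a" := (enum_rank ((m, a) : idx))
  (at level 10, m at level 9, a at level 9).

Definition coef_fun (v : 'cV[K]_#|idx|) (r : 'I_N -> Omega) : {ffun M l0 -> F} :=
  [ffun a => \sum_(m : multi_index M l) v (idx_pair m a) 0 *: phi_multi phi m r].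

Lemma coef_fun_sum (I : finType) (x : I -> K) (v : I -> 'cV[K]_#|idx|) :
  coef_fun (\sum_i x i *: v i) = \sum_i x i *: coef_fun (v i).
Proof.
apply/funext => r; rewrite fct_sumE; apply/ffunP => a.
rewrite sum_ffunE ffunE.
under eq_bigr => m _ do rewrite summxE scaler_suml.
rewrite exchange_big; apply: eq_bigr => i _; rewrite !ffunE scaler_sumr.
by apply: eq_bigr => m _; rewrite mxE scalerA.
Qed.

Lemma coef_fun_inj (v : 'cV[K]_#|idx|) :
  (forall a : multi_index M l -> K,
    \sum_m a m *: phi_multi phi m = 0 -> forall m, a m = 0) ->
  coef_fun v = 0 -> v = 0.
Proof.
move=> free v0; apply/matrixP => p q; rewrite ord1 [RHS]mxE -(enum_valK p).
case: (enum_val p) => m a; apply: (free (fun m => v (idx_pair m a) 0)).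
rewrite fct_sumE; apply/funext => r.
by have /(congr1 (fun f : _ -> {ffun M l0 -> F} => f r a)) := v0; rewrite ffunE ffunE.
Qed.

Lemma coef_fun_surj (f : ('I_N -> Omega) -> {ffun M l0 -> F}) :
  (forall a, Vtensor phi l (fun r => f r a)) ->
  exists v, f = coef_fun v.
Proof.
move=> Vf; have H a := Vtensor_coefs (Vf a).
have [c cP] := choice H.
exists (\col_p c (enum_val p).2 (enum_val p).1).
apply/funext => r; apply/ffunP => a; rewrite ffunE.
have /(congr1 (fun h => h r)) /= -> := cP a; rewrite fct_sumE.
by apply: eq_bigr => m _; rewrite mxE enum_rankK.
Qed.

Lemma coef_fun_Vtensor v a : Vtensor phi l (fun r => coef_fun v r a).
Proof.
have -> : (fun r => coef_fun v r a) = \sum_m v (idx_pair m a) 0 *: phi_multi phi m.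
  by rewrite fct_sumE; apply/funext => r; rewrite ffunE.
elim/big_ind : _ => [|f g Vf Vg|m _]; first exact: lspan0.
  by rewrite -[f]scale1r; exact: lspan_linear.
by rewrite -[_ *: _]addr0; apply: lspan_linear; [exact: phi_multi_Vtensor|exact: lspan0].
Qed.

Variables (n : nat) (G : set 'M[scalar_field R Complexes]_n).
Variable act : 'M[scalar_field R Complexes]_n -> Omega -> Omega.
Variable rho : forall l : L, 'M[scalar_field R Complexes]_n -> M l -> M l -> K.

(** Both sides of the equivariance equation are expanded in the functions
    [phi_multi phi m'], whose coefficients are then compared. *)
Lemma equivariant_coef_fun (v : 'cV[K]_#|idx|) :
  (forall a : multi_index M l -> K,
    \sum_m a m *: phi_multi phi m = 0 -> forall m, a m = 0) ->
  (forall (l : L) g, G g -> forall (m : M l) (r : Omega),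
     phi m (act g r) = \sum_(m' : M l) rho g m m' *: phi m' r) ->
  equivariant G act (@rho l0) (coef_fun v) <->
  forall g, G g ->
    mx_of (fun a m => v (idx_pair m a) 0) *m mx_of (tensor_rep rho g) =
    mx_of (@rho l0 g) *m mx_of (fun a m => v (idx_pair m a) 0).
Proof.
move=> free hrho.
have lhs g r a : G g -> coef_fun v (fun i => act g (r i)) a =
    \sum_m' (\sum_m v (idx_pair m a) 0 * tensor_rep rho g m m') *: phi_multi phi m' r.
  move=> Gg; rewrite ffunE.
  under eq_bigr => m _ do rewrite (phi_multi_act _ _ hrho Gg) scaler_sumr.
  rewrite exchange_big; apply: eq_bigr => m' _; rewrite scaler_suml.
  by apply: eq_bigr => m _; rewrite scalerA.
have rhs g r a : \sum_b rho g a b *: coef_fun v r b =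
    \sum_m' (\sum_b rho g a b * v (idx_pair m' b) 0) *: phi_multi phi m' r.
  under eq_bigr => b _ do rewrite ffunE scaler_sumr.
  rewrite exchange_big; apply: eq_bigr => m' _; rewrite scaler_suml.
  by apply: eq_bigr => b _; rewrite scalerA.
split=> [eqv g Gg|H g Gg r a].
  rewrite !mx_of_mul; apply/eq_mx_of => a m'; apply/eqP; rewrite -subr_eq0; apply/eqP.
  apply: (free (fun m' => \sum_m v (idx_pair m a) 0 * tensor_rep rho g m m' -
    \sum_b rho g a b * v (idx_pair m' b) 0)).
  rewrite fct_sumE; apply/funext => r.
  under eq_bigr do rewrite fctE scalerBl.
  by rewrite sumrB -lhs// -rhs eqv// subrr.
rewrite lhs// rhs; apply: eq_bigr => m' _; congr (_ *: _).
by have := H g Gg; rewrite !mx_of_mul => /eq_mx_of ->.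
Qed.

End CoefficientFunctions.

Theorem proposition2p1
  (R : realType) (k : scalar_kind)
  (F : comAlgType (scalar_field R k))
  (* connected linear Lie group and generators of its Lie algebra *)
  (n : nat) (G : set 'M[scalar_field R Complexes]_n)
  (hG : linear_lie_group G) (hGconn : connected G)
  (Ndim : nat) (X : 'I_Ndim -> 'M[scalar_field R Complexes]_n)
  (hX : lie_generates X (lie_algebra G))
  (* action on the domain *)
  (Omega : Type) (act : 'M[scalar_field R Complexes]_n -> Omega -> Omega)
  (hact : is_action G act)
  (* orthonormal one-particle functions *)
  (dL : Order.disp_t) (L : orderType dL) (hL : countable [set: L])
  (dM : Order.disp_t) (M : L -> finOrderType dM)
  (phi : forall l : L, M l -> Omega -> F)
  (ip : (Omega -> F) -> (Omega -> F) -> scalar_field R k)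
  (hip : is_scalar_product (Vtotal phi) ip)
  (hphi : orthonormal_family phi ip)
  (* representations carried by the spaces V^l *)
  (rho : forall l : L,
     'M[scalar_field R Complexes]_n -> M l -> M l -> scalar_field R k)
  (hrho : forall (l : L) g, G g -> forall (m : M l) (r : Omega),
     phi l m (act g r) = \sum_(m' : M l) rho l g m m' *: phi l m' r)
  (hrho_cont : forall l : L, continuous_rep G (rho l))
  (* the multi-index, the tensor product space and the target representation *)
  (N : nat) (hN : (0 < N)%N) (l : 'I_N -> L) (l0 : L)
  (ipN : (('I_N -> Omega) -> F) -> (('I_N -> Omega) -> F) -> scalar_field R k)
  (hipN : is_tensor_scalar_product phi l ip ipN) :
  let varrho := fun (l' : L) (d : 'I_Ndim) => drep (rho l') (X d) in
  let K := ker_M varrho l l0 in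
  let V := GE_space phi l G act (rho l0) in
  (forall c : (\dim K).-tuple 'cV[scalar_field R k]_#|index_set M l l0|,
     basis_of K c ->
     is_basis V
       (fun (i : 'I_(\dim K)) (r : 'I_N -> Omega) =>
          [ffun a : M l0 =>
             \sum_(m : multi_index M l)
               tnth c i (enum_rank ((m, a) : index_set M l l0)) 0 *:
                 phi_multi phi m r]))
  /\ has_dim V (\dim K).
Proof.
move=> varrho K V.
have free := phi_multi_free hphi hipN.
have hrep l' : matrix_rep G (rho l').
  refine (matrix_rep_functions hG hact (phi_free hip hphi) (hrho l') (hrho_cont l')).
have hactN : is_action G (fun g (r : 'I_N -> Omega) i => act g (r i)).
  split=> [r|g h Gg Gh r]; apply/funext => i; first exact: hact.1.
  exact: hact.2.
have hP : matrix_rep G (tensor_rep (l := l) rho).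
  apply: (matrix_rep_functions hG hactN free).
    by move=> g Gg m r; exact: (phi_multi_act m r hrho Gg).
  exact: (tensor_rep_continuous hrho_cont).
have memV (v : 'cV_#|index_set M l l0|) : V (coef_fun phi v) <-> v \in K.
  split=> [[eqv _]|vK].
    move/(equivariant_coef_fun v free hrho) : eqv.
    move/(intertwiner_generators hG hGconn hX _ hP (hrep l0)) => H.
    apply/ker_MP => d m a; have := H d; rewrite !mx_of_mul => /eq_mx_of /(_ a m) <-.
    apply: eq_bigr => m' _; rewrite mulrC; congr (_ * _).
    by rewrite (drep_tensor _ _ (mem_generators d hX) hrep hP).
  split; last by move=> a; exact: coef_fun_Vtensor.
  apply/(equivariant_coef_fun v free hrho).
  apply/(intertwiner_generators hG hGconn hX _ hP (hrep l0)) => d.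
  rewrite !mx_of_mul; apply/eq_mx_of => a m.
  move/ker_MP : vK => /(_ d m a) <-.
  apply: eq_bigr => m' _; rewrite mulrC; congr (_ * _).
  by rewrite (drep_tensor _ _ (mem_generators d hX) hrep hP).
have basis (c : (\dim K).-tuple 'cV_#|index_set M l l0|) : basis_of K c ->
    is_basis V (fun i => coef_fun phi (tnth c i)).
  move=> cK; split=> [a a0 i|].
    have /freeP := basis_free cK; apply.
    apply: (coef_fun_inj free); rewrite -[RHS]a0 coef_fun_sum; apply: eq_bigr => j _.
    by rewrite (tnth_nth 0).
  apply/seteqP; split=> [_ [p [a [f [fc ->]]]]|f Vf].
    have [s sP] := choice (fun j => let: ex_intro2 i _ e := fc j in ex_intro _ i e).
    under eq_bigr => j _ do rewrite -sP.
    rewrite -coef_fun_sum; apply/memV; apply: memv_suml => j _; apply: memvZ.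
    by apply: (basis_mem cK); exact: mem_tnth.
  have [v fv] := coef_fun_surj Vf.2; rewrite fv in Vf *.
  move/memV : Vf => vK; rewrite (coord_basis cK vK) coef_fun_sum.
  by apply: lspan_sum => i; exists i => //; rewrite (tnth_nth 0).
split; first exact: basis.
by exists (fun i => coef_fun phi (tnth (vbasis K) i)); apply: basis; exact: vbasisP.
Qed.
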